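(* $\#\mathrm{para}_{\beta}\text{-}\mathrm{L}\subseteq \mathrm{FFPT}$.
   Context: Inputs are pairs $(x,k)$ with $x\in\{0,1\}^*$ and parameter $k\in\mathbb N$; a parameterised function is a function $F:\{0,1\}^*\times\mathbb N\to\mathbb N$. Machines are TMs with random access to the input. A nondeterministic TM is a deterministic TM with an additional read-only choice tape (not counted for space); a nondeterministic step is one in which the choice-tape head moves to a previously unvisited cell; $\#\mathrm{acc}_M(x,k)$ is the number of accepting computation paths of $M$ on $(x,k)$. A $\mathrm{para}\text{-}\mathrm{L}$-machine uses space $O(\log|x|+f(k))$ on input $(x,k)$ for some computable $f$. A nondeterministic machine is $k$-bounded if for some computable $f$ it reads at most $f(k)\cdot\log|x|$ choice-tape bits on every input $(x,k)$; it has read-once access if its choice-tape head moves only one way. $\#\mathrm{para}_{\beta}\text{-}\mathrm{L}$ is the class of parameterised functions $F$ for which there is a $k$-bounded nondeterministic $\mathrm{para}\text{-}\mathrm{L}$-machine $M$ with read-once access to its nondeterministic bits such that $\#\mathrm{acc}_M(x,k)=F(x,k)$ for all $(x,k)$. $\mathrm{FFPT}$ is the class of functions computable by deterministic TMs with output in time $f(k)\cdot p(|x|)$ for a computable $f$ and a polynomial $p$. *)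

(* Defs.v *)
From mathcomp Require Import all_boot.

Set Implicit Arguments.
Unset Strict Implicit.
Unset Printing Implicit Defensive.

(* A machine has a finite control, one read/write work tape, one        *)
(* read/write index tape (both over {blank,0,1}, both counted for      *)
(* space), random access to the input (x,k): in every step it sees      *)
(*   - the bit x[i] (None if i >= |x|), and                              *)
(*   - whether i < k (k is thus available in unary, random access),      *)
(* where i is the number written (little-endian binary) on the index    *)
(* tape; a write-only output tape; and read-once, one-way access to a   *)
(* choice tape: an action [AChoose q0 q1] reads the next (previously     *)
(* unvisited) choice bit b and continues in q_b (a nondeterministic      *)
(* step).                                                                *)

Inductive move := MLeft | MStay | MRight.

Record view := View {
  v_input : option bool;   (* x[i], None if i >= |x| *)
  v_param : bool;          (* i < k *)
  v_work  : option bool;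
  v_index : option bool
}.

Inductive action (Q : Type) :=
| AHalt (accept : bool)
| AChoose (q0 q1 : Q)
| AStep (q : Q) (work_write : option bool) (work_move : move)
        (index_write : option bool) (index_move : move)
        (output : option bool).

Arguments AHalt {Q}.

Record TM := {
  tm_state : finType;
  tm_start : tm_state;
  tm_delta : tm_state -> view -> action tm_state
}.

Record tape := Tape { t_cells : seq (option bool); t_head : nat }.

Definition empty_tape := Tape [::] 0.
Definition tape_read (t : tape) := nth None (t_cells t) (t_head t).
Definition tape_write (t : tape) (s : option bool) :=
  Tape (set_nth None (t_cells t) (t_head t) s) (t_head t).
Definition tape_move (t : tape) (m : move) :=
  Tape (t_cells t)
       match m with MLeft => (t_head t).-1 | MStay => t_head t
                  | MRight => (t_head t).+1 end.
(* value of the index tape: little-endian binary, blanks count as 0 *)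
Definition tape_value (t : tape) : nat :=
  foldr (fun c acc => (c == Some true) + acc.*2) 0 (t_cells t).

Inductive status (Q : Type) := Running (q : Q) | Halted (accept : bool) | Dead.
Arguments Halted {Q}.
Arguments Dead {Q}.

Record config (Q : Type) := Config {
  cf_status  : status Q;
  cf_work    : tape;
  cf_index   : tape;
  cf_choices : seq bool;   (* unread part of the choice tape *)
  cf_output  : seq bool
}.

Definition init (M : TM) (c : seq bool) : config (tm_state M) :=
  Config (Running (tm_start M)) empty_tape empty_tape c [::].

Definition step (M : TM) (x : seq bool) (k : nat)
    (cf : config (tm_state M)) : config (tm_state M) :=
  match cf_status cf with
  | Running q =>
      let i := tape_value (cf_index cf) in
      let v := View (nth None (map Some x) i) (i < k)
                    (tape_read (cf_work cf)) (tape_read (cf_index cf)) in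
      match tm_delta q v with
      | AHalt b => Config (Halted b) (cf_work cf) (cf_index cf)
                          (cf_choices cf) (cf_output cf)
      | AChoose q0 q1 =>
          match cf_choices cf with
          | [::] => Config Dead (cf_work cf) (cf_index cf) [::] (cf_output cf)
          | b :: cs => Config (Running (if b then q1 else q0)) (cf_work cf)
                              (cf_index cf) cs (cf_output cf)
          end
      | AStep q' ww wm iw im o =>
          Config (Running q')
                 (tape_move (tape_write (cf_work cf) ww) wm)
                 (tape_move (tape_write (cf_index cf) iw) im)
                 (cf_choices cf)
                 (match o with Some b => rcons (cf_output cf) b
                             | None => cf_output cf end)
      end
  | _ => cf
  end.

Definition conf_at (M : TM) (x : seq bool) (k : nat) (c : seq bool) (n : nat)
  : config (tm_state M) := iter n (@step M x k) (init M c).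

Definition halted (Q : Type) (cf : config Q) : bool :=
  if cf_status cf is Halted _ then true else false.

(* output tape read as a binary number, most significant bit first *)
Definition out_val (s : seq bool) : nat := foldl (fun a (b : bool) => a.*2 + nat_of_bool b) 0 s.

(* log|x|, rounded up generously so that it is >= 1 *)
Definition ilog (n : nat) : nat := (trunc_log 2 n).+1.

Definition computable (f : nat -> nat) : Prop :=
  exists M : TM, forall k, exists n,
    halted (conf_at M [::] k [::] n) /\
    out_val (cf_output (conf_at M [::] k [::] n)) = f k.

(* the computation path with choice sequence c is accepting: the machine
   accepts having read exactly the bits c *)
Definition accepting_path (M : TM) (x : seq bool) (k : nat) (c : seq bool) : Prop :=
  exists n, cf_status (conf_at M x k c n) = Halted true /\
            cf_choices (conf_at M x k c n) = [::].

Definition num_acc (M : TM) (x : seq bool) (k : nat) (N : nat) : Prop :=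
  exists s : seq (seq bool),
    [/\ uniq s, (forall c, c \in s <-> accepting_path M x k c) & size s = N].

(* para-L machine: space O(log|x| + f(k)) on every computation path *)
Definition paraL_machine (M : TM) : Prop :=
  exists f, computable f /\ exists C, forall x k c n,
    t_head (cf_work  (conf_at M x k c n)) <= C * (ilog (size x) + f k) /\
    t_head (cf_index (conf_at M x k c n)) <= C * (ilog (size x) + f k).

Definition k_bounded (M : TM) : Prop :=
  exists f, computable f /\ forall x k c n,
    size c - size (cf_choices (conf_at M x k c n)) <= f k * ilog (size x).

Definition param_fun := seq bool -> nat -> nat.

Definition sharp_para_beta_L (F : param_fun) : Prop :=
  exists M : TM, [/\ paraL_machine M, k_bounded M & forall x k, num_acc M x k (F x k)].

Definition peval (p : seq nat) (n : nat) : nat := foldr (fun a acc => a + n * acc) 0 p.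

(* deterministic: run with an empty choice tape (a choice step would be fatal) *)
Definition FFPT (F : param_fun) : Prop :=
  exists (M : TM) (f : nat -> nat) (p : seq nat), computable f /\
    forall x k, exists n, n <= f k * peval p (size x) /\
      halted (conf_at M x k [::] n) /\
      out_val (cf_output (conf_at M x k [::] n)) = F x k.

(* Main.v *)
Require Import Defs.
From mathcomp Require Import all_boot zify.

(* The counting machine keeps a table that assigns to configurations of [M] a
   number in binary, initially only the start configuration with 0. A pass
   recomputes every number from the numbers of the successor configurations
   and adds missing successors with 0; passes are repeated until the table no
   longer changes, and then the number of the start configuration is printed.
   A fixpoint of the pass holds the numbers of accepting paths. Let S be the
   number of reachable configurations; by the space bound it is at most
   2^O(log |x| + f(k)). A cycle in the configuration graph reads no choice bit,
   since otherwise pumping it would read too many; hence accepting paths never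
   repeat a configuration, a fixpoint is reached after O(S) passes, and all
   numbers are at most 2^S. Storing multiplicities in the table is what avoids
   the enumeration of the |x|^f(k) choice sequences.

   The machine is produced in three steps: structured commands on the raw tapes
   become states of a [TM]; the work tape is split into tracks holding stacks;
   and one stack holds binary trees, on which polynomial-time functions are
   closed under the usual constructions. *)

Set Implicit Arguments.
Unset Strict Implicit.
Unset Printing Implicit Defensive.

(** * Structured commands and their compilation *)

(** The counting machine must not evaluate f: computability of f gives no bound on the time for
    computing f(k). So it neither allocates a table of known size nor counts passes; it discovers
    configurations on demand and stops when a pass changes nothing. S and the number of passes occur
    only in the analysis. FFPT still asks for a computable factor in k, and a separate machine, free
    of time constraints, witnesses that one exists. The equations that express a number by those of
    the successors do not determine it: around a cycle that reads no bit, every constant is a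
    solution. Numbers that start from 0 stay below the true ones, while a fixpoint also dominates,
    by induction on i, the number of paths with at most i configurations; the two bounds squeeze it
    onto the true numbers. The final estimate rests on a splitting: a polynomial in 2^O(log |x| +
    f(k)) is a power of |x| times a factor in k alone. *)

Record act := Act {
  a_ww : option bool; a_wm : move; a_iw : option bool; a_im : move; a_out : option bool }.

(** A machine step always writes, so a mere test rewrites both scanned cells. This can append blanks
    to the cell lists, and therefore [run] passes on [mapply (nop _) m] and not [m] itself. *)
Definition nop (v : view) := Act (v_work v) MStay (v_index v) MStay None.

Inductive cmd :=
| Do (f : view -> act)
| Seq (a b : cmd)
| If (c : view -> bool) (a b : cmd)
| While (c : view -> bool) (a : cmd).

Record mstate := MState { m_work : tape; m_index : tape; m_out : seq bool }.

Definition mapply (a : act) (m : mstate) : mstate :=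
  MState (tape_move (tape_write (m_work m) (a_ww a)) (a_wm a))
         (tape_move (tape_write (m_index m) (a_iw a)) (a_im a))
         (match a_out a with Some b => rcons (m_out m) b | None => m_out m end).

Definition input := (seq bool * nat)%type.

Definition mview (X : input) (m : mstate) : view :=
  let i := tape_value (m_index m) in
  View (nth None (map Some X.1) i) (i < X.2) (tape_read (m_work m)) (tape_read (m_index m)).

Inductive run (X : input) : cmd -> mstate -> mstate -> nat -> Prop :=
| run_Do f m : run X (Do f) m (mapply (f (mview X m)) m) 1
| run_Seq a b m m' m'' n n' :
    run X a m m' n -> run X b m' m'' n' -> run X (Seq a b) m m'' (n + n')
| run_If (c : view -> bool) a b m m' n :
    run X (if c (mview X m) then a else b) (mapply (nop (mview X m)) m) m' n ->
    run X (If c a b) m m' n.+1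
| run_While_false (c : view -> bool) a m :
    ~~ c (mview X m) -> run X (While c a) m (mapply (nop (mview X m)) m) 1
| run_While_true (c : view -> bool) a m m' m'' n n' :
    c (mview X m) -> run X a (mapply (nop (mview X m)) m) m' n ->
    run X (While c a) m' m'' n' -> run X (While c a) m m'' (n + n').+1.

Fixpoint states (c : cmd) : finType :=
  match c with
  | Do _ => unit
  | Seq a b => (states a + states b)%type
  | If _ a b => option (states a + states b)
  | While _ a => option (states a)
  end.

Fixpoint start (c : cmd) : states c :=
  match c with
  | Do _ => tt
  | Seq a b => inl (start a)
  | If _ a b => None
  | While _ a => None
  end.

(** [None] as next state means leaving the command. The enclosing command redirects this exit within
    the same step, so sequencing costs no time. *)
Fixpoint delta (c : cmd) : states c -> view -> option (states c) * act :=
  match c with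
  | Do f => fun _ v => (None, f v)
  | Seq a b => fun q v =>
      match q with
      | inl qa => let: (q', t) := delta qa v in
                  (Some (if q' is Some qa' then inl qa' else inr (start b)), t)
      | inr qb => let: (q', t) := delta qb v in (omap inr q', t)
      end
  | If c a b => fun q v =>
      match q with
      | None => (Some (Some (if c v then inl (start a) else inr (start b))), nop v)
      | Some (inl qa) => let: (q', t) := delta qa v in (omap (fun q => Some (inl q)) q', t)
      | Some (inr qb) => let: (q', t) := delta qb v in (omap (fun q => Some (inr q)) q', t)
      end
  | While c a => fun q v =>
      match q with
      | None => (if c v then Some (Some (start a)) else None, nop v)
      | Some qa => let: (q', t) := delta qa v in (Some q', t)
      end
  end.

Inductive exits (X : input) (Q : Type) (d : Q -> view -> option Q * act) :
  Q -> mstate -> mstate -> nat -> Prop :=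
| exits_one q m t : d q (mview X m) = (None, t) -> exits X d q m (mapply t m) 1
| exits_next q m q' t m' n : d q (mview X m) = (Some q', t) ->
    exits X d q' (mapply t m) m' n -> exits X d q m m' n.+1.

Lemma exits_embed X (Q Q' : Type) (d : Q -> view -> option Q * act)
    (d' : Q' -> view -> option Q' * act) (emb : Q -> Q') q m m' n :
  (forall q v, d' (emb q) v = let: (r, t) := d q v in (omap emb r, t)) ->
  exits X d q m m' n -> exits X d' (emb q) m m' n.
Proof.
move=> E; elim=> {q m m' n} [q m t H|q m q' t m' n H _ IH].
- by apply: exits_one; rewrite E H.
- by apply: exits_next IH; rewrite E H.
Qed.

(** The state [r] that receives the exits is the start of the second command for [Seq] and the test
    state for [While]. *)
Lemma exits_chain X (Q Q' : Type) (d : Q -> view -> option Q * act)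
    (d' : Q' -> view -> option Q' * act) (emb : Q -> Q') r q m m' m'' n n' :
  (forall q v, d' (emb q) v =
     let: (q', t) := d q v in (Some (if q' is Some p then emb p else r), t)) ->
  exits X d q m m' n -> exits X d' r m' m'' n' -> exits X d' (emb q) m m'' (n + n').
Proof.
move=> E; elim=> {q m m' n} [q m t H|q m q' t m' n H _ IH] K.
- by apply: exits_next K; rewrite E H.
- by rewrite addSn; apply: exits_next (IH K); rewrite E H.
Qed.

Lemma run_exits X c m m' n : run X c m m' n -> exits X (@delta c) (start c) m m' n.
Proof.
elim=> {c m m' n} [f m|a b m m' m'' n n' _ IHa _ IHb|c a b m m' n _ IH
  |c a m H|c a m m' m'' n n' H _ IHa _ IHw].
- exact: exits_one.
- apply: (@exits_chain X _ _ _ (@delta (Seq a b)) inl (inr (start b)) _ _ _ _ _ _ _ IHa) => //.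
  exact: (@exits_embed X _ _ _ (@delta (Seq a b)) inr _ _ _ _ _ IHb).
- case H: (c (mview X m)) IH => IH.
  + apply: (@exits_next _ _ _ _ _ (Some (inl (start a)))); first by rewrite /= H.
    by apply: (@exits_embed X _ _ _ (@delta (If c a b)) (fun q => Some (inl q)) _ _ _ _ _ IH).
  + apply: (@exits_next _ _ _ _ _ (Some (inr (start b)))); first by rewrite /= H.
    by apply: (@exits_embed X _ _ _ (@delta (If c a b)) (fun q => Some (inr q)) _ _ _ _ _ IH).
- by apply: exits_one; rewrite /= (negbTE H).
- apply: (@exits_next _ _ _ _ _ (Some (start a))); first by rewrite /= H.
  apply: (@exits_chain X _ _ _ (@delta (While c a)) Some None _ _ _ _ _ _ _ IHa IHw).
  by move=> q v /=; case: (delta q v) => [[q'|] t].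
Qed.

(** No transition is an [AChoose], so the machine is deterministic. The extra state [None] only
    halts, which accounts for the additional step in [run_tm_of]. *)
Definition tm_of (c : cmd) : TM :=
  {| tm_state := option (states c);
     tm_start := Some (start c);
     tm_delta := fun q v =>
       if q is Some q then
         let: (q', t) := delta q v in
         AStep q' (a_ww t) (a_wm t) (a_iw t) (a_im t) (a_out t)
       else AHalt true |}.

Definition blank_mstate := MState empty_tape empty_tape [::].

Lemma exits_iter_step (c : cmd) x k q m m' n : exits (x, k) (@delta c) q m m' n ->
  iter n (@step (tm_of c) x k)
    (Config (Running (Some q : tm_state (tm_of c))) (m_work m) (m_index m) [::] (m_out m))
  = Config (Running (None : tm_state (tm_of c))) (m_work m') (m_index m') [::] (m_out m').
Proof.
elim=> {q m m' n} [q m t H|q m q' t m' n H _ IH].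
- by rewrite /= /step /=; rewrite -[View _ _ _ _]/(mview (x, k) m) H.
- by rewrite iterSr -IH /step /=; rewrite -[View _ _ _ _]/(mview (x, k) m) H.
Qed.

Lemma run_tm_of c x k m n : run (x, k) c blank_mstate m n ->
  halted (conf_at (tm_of c) x k [::] n.+1) /\
  cf_output (conf_at (tm_of c) x k [::] n.+1) = m_out m.
Proof.
by move=> /run_exits/exits_iter_step E; rewrite /conf_at iterS E /step.
Qed.
(** * Stacks on the work tape *)

(* Tapes that differ only by trailing blanks are identified. *)
Definition teq (t t' : tape) :=
  t_head t = t_head t' /\ forall p, nth None (t_cells t) p = nth None (t_cells t') p.

Lemma teq_trans t t' t'' : teq t t' -> teq t' t'' -> teq t t''.
Proof. by move=> [h1 c1] [h2 c2]; split=> [|p]; rewrite ?h1 ?c1. Qed.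

Lemma teq_read t t' : teq t t' -> tape_read t = tape_read t'.
Proof. by move=> [h c]; rewrite /tape_read h c. Qed.

Lemma teq_write_move t t' s d : teq t t' ->
  teq (tape_move (tape_write t s) d) (tape_move (tape_write t' s) d).
Proof.
move=> [h c]; split=> [|p] /=; first by rewrite h.
by rewrite !nth_set_nth /= h c.
Qed.

Lemma teq_rewrite t : teq (tape_move (tape_write t (tape_read t)) MStay) t.
Proof. by split=> [|p] //=; rewrite nth_set_nth /=; case: eqP => [->|]. Qed.

Lemma teq_value t t' : teq t t' -> tape_value t = tape_value t'.
Proof.
case: t t' => [c h] [c' h'] [_ /= E]; rewrite /tape_value /=.
have Z : forall s, (forall p, nth None s p = None :> option bool) ->
    foldr (fun c acc => (c == Some true) + acc.*2) 0 s = 0.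
  elim=> //= a s IH H; rewrite IH => [|p]; last exact: (H p.+1).
  by rewrite (H 0 : a = None).
elim: c c' E => [|a c IH] [|a' c'] E //=.
- have H p := esym (E p); rewrite [foldr _ _ _]Z => [|p];
    last by rewrite -[LHS]/(nth None (a' :: c') p.+1) H nth_nil.
  by rewrite (H 0 : a' = None).
- rewrite [foldr _ _ _]Z => [|p]; last by rewrite -[LHS]/(nth None (a :: c) p.+1) E nth_nil.
  by rewrite (E 0 : a = None).
- by rewrite (E 0 : a = a') (IH c') // => p; exact: (E p.+1).
Qed.

(** A total function of cells is insensitive to trailing blanks on the work tape. The index tape
    stays a tape because its value is computed from the list of cells. *)
Record astate := AState {
  as_cell : nat -> option bool; as_head : nat; as_index : tape; as_out : seq bool }.

Definition rep (a : astate) (m : mstate) :=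
  [/\ t_head (m_work m) = as_head a,
      forall p, nth None (t_cells (m_work m)) p = as_cell a p,
      teq (m_index m) (as_index a) & m_out m = as_out a].

Definition aeq (a a' : astate) :=
  [/\ as_head a = as_head a', as_cell a =1 as_cell a',
      teq (as_index a) (as_index a') & as_out a = as_out a'].

Lemma rep_aeq a a' m : aeq a a' -> rep a m -> rep a' m.
Proof.
move=> [h1 c1 i1 o1] [h2 c2 i2 o2]; split; rewrite -?h1 -?o1 //.
- by move=> p; rewrite c2.
- exact: teq_trans i2 i1.
Qed.

Definition aview (X : input) (a : astate) : view :=
  let i := tape_value (as_index a) in
  View (nth None (map Some X.1) i) (i < X.2) (as_cell a (as_head a)) (tape_read (as_index a)).

Lemma rep_view X a m : rep a m -> mview X m = aview X a.
Proof.
move=> [h c i o]; rewrite /mview /aview (teq_value i) (teq_read i).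
by rewrite /tape_read h c.
Qed.

Definition aapply (t : act) (a : astate) : astate :=
  AState (fun p => if p == as_head a then a_ww t else as_cell a p)
         (match a_wm t with MLeft => (as_head a).-1 | MStay => as_head a
                          | MRight => (as_head a).+1 end)
         (tape_move (tape_write (as_index a) (a_iw t)) (a_im t))
         (match a_out t with Some b => rcons (as_out a) b | None => as_out a end).

Lemma rep_apply t a m : rep a m -> rep (aapply t a) (mapply t m).
Proof.
move=> [h c i o]; split=> /=; rewrite ?h ?o //.
- by move=> p; rewrite nth_set_nth /= c.
- exact: teq_write_move.
Qed.

Lemma aapply_nop X a : aeq (aapply (nop (aview X a)) a) a.
Proof.
split=> //=; first by move=> p /=; case: eqP => [->|].
exact: teq_rewrite.
Qed.

Definition exec_raw X c (a a' : astate) n :=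
  forall m, rep a m -> exists m' n', [/\ run X c m m' n', rep a' m' & n' <= n].

Section Triples.
Variable X : input.
Local Notation exec_raw := (exec_raw X).

Lemma raw_Do f a a' : aeq (aapply (f (aview X a)) a) a' -> exec_raw (Do f) a a' 1.
Proof.
move=> E m H; exists (mapply (f (mview X m)) m), 1; split=> //; first exact: run_Do.
by rewrite (rep_view X H); apply: rep_aeq E _; apply: rep_apply.
Qed.

Lemma raw_Seq c d a a' a'' n n' :
  exec_raw c a a' n -> exec_raw d a' a'' n' -> exec_raw (Seq c d) a a'' (n + n').
Proof.
move=> Hc Hd m /Hc[m1 [n1 [r1 /Hd[m2 [n2 [r2 p2 l2]]] l1]]].
by exists m2, (n1 + n2); split; [apply: run_Seq r1 r2| |lia].
Qed.

Lemma raw_If p c d a a' n :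
  exec_raw (if p (aview X a) then c else d) a a' n -> exec_raw (If p c d) a a' n.+1.
Proof.
move=> H m Hm.
have /H[m1 [n1 [r1 p1 l1]]] : rep a (mapply (nop (mview X m)) m).
  rewrite (rep_view X Hm); apply: rep_aeq (aapply_nop X a) _; exact: rep_apply.
by exists m1, n1.+1; split=> //; apply: run_If; rewrite (rep_view X Hm) in r1 *.
Qed.

Lemma raw_While_false (p : view -> bool) c a : ~~ p (aview X a) -> exec_raw (While p c) a a 1.
Proof.
move=> H m Hm; exists (mapply (nop (mview X m)) m), 1; split=> //.
- by apply: run_While_false; rewrite (rep_view X Hm).
- by rewrite (rep_view X Hm); apply: rep_aeq (aapply_nop X a) _; exact: rep_apply.
Qed.

Lemma raw_While_true (p : view -> bool) c a a' a'' n n' : p (aview X a) ->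
  exec_raw c a a' n -> exec_raw (While p c) a' a'' n' -> exec_raw (While p c) a a'' (n + n').+1.
Proof.
move=> H Hc Hw m Hm.
have /Hc[m1 [n1 [r1 /Hw[m2 [n2 [r2 p2 l2]]] l1]]] : rep a (mapply (nop (mview X m)) m).
  rewrite (rep_view X Hm); apply: rep_aeq (aapply_nop X a) _; exact: rep_apply.
exists m2, (n1 + n2).+1; split=> //; last by lia.
by apply: run_While_true r1 r2; rewrite (rep_view X Hm).
Qed.

Lemma raw_leq c a a' n n' : n <= n' -> exec_raw c a a' n -> exec_raw c a a' n'.
Proof.
by move=> l H m /H[m1 [n1 [r1 p1 l1]]]; exists m1, n1; split=> //; apply: leq_trans l1 l.
Qed.

Definition go (d : move) := Do (fun v => Act (v_work v) d (v_index v) MStay None).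
Definition put s := Do (fun v => Act s MStay (v_index v) MStay None).
Definition goes (d : move) n := iter n (Seq (go d)) (go MStay).

Lemma raw_go d g h ti o : exec_raw (go d) (AState g h ti o)
  (AState g (match d with MLeft => h.-1 | MStay => h | MRight => h.+1 end) ti o) 1.
Proof.
apply: raw_Do; split=> //=; first by move=> p /=; case: eqP => [->|].
exact: teq_rewrite.
Qed.

Lemma raw_put s g g' h ti o : (forall p, (if p == h then s else g p) = g' p) ->
  exec_raw (put s) (AState g h ti o) (AState g' h ti o) 1.
Proof. by move=> E; apply: raw_Do; split=> //=; exact: teq_rewrite. Qed.

Lemma raw_goesR n g h ti o :
  exec_raw (goes MRight n) (AState g h ti o) (AState g (h + n) ti o) n.+1.
Proof.
elim: n h => [|n IH] h; first by rewrite addn0; apply: (raw_go MStay).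
rewrite -[n.+2]add1n addnS -addSn; apply: raw_Seq (IH _); exact: (raw_go MRight).
Qed.

Lemma raw_goesL n g h ti o :
  exec_raw (goes MLeft n) (AState g (h + n) ti o) (AState g h ti o) n.+1.
Proof.
elim: n h => [|n IH] h; first by rewrite addn0; apply: (raw_go MStay).
rewrite -[n.+2]add1n; apply: raw_Seq (IH _).
by rewrite addnS; apply: (raw_go MLeft).
Qed.

(** Five stacks and one marker track are interleaved: cell j of track i lies at [i + width * j]. *)
Definition width := 6.

Definition scan := While (fun v => v_work v != None) (goes MRight width).
Definition home i :=
  Seq (goes MLeft i) (While (fun v => v_work v == None) (goes MLeft width)).

(** One block costs 8 steps: a test, six moves and the closing [MStay] of [goes]. *)
Lemma raw_scan g i j n ti o :
  (forall l, j <= l < j + n -> g (i + width * l) != None) -> g (i + width * (j + n)) = None ->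
  exec_raw scan (AState g (i + width * j) ti o) (AState g (i + width * (j + n)) ti o) (8 * n).+1.
Proof.
elim: n j => [|n IH] j H0 H1.
  by rewrite addn0 in H1 *; apply: raw_While_false; rewrite /= H1.
have -> : (8 * n.+1).+1 = (7 + (8 * n).+1).+1 by lia.
apply: raw_While_true; first by rewrite /= H0 //; lia.
  exact: raw_goesR.
have -> : i + width * j + width = i + width * j.+1 by lia.
by rewrite addnS -addSn; apply: IH => [l Hl|]; [apply: H0; lia | rewrite addSn -addnS].
Qed.

Lemma raw_home g i j ti o :
  (forall l, 0 < l <= j -> g (width * l) = None) -> g 0 != None ->
  exec_raw (home i) (AState g (i + width * j) ti o) (AState g 0 ti o) (i + 8 * j + 2).
Proof.
move=> H0 H1; apply: (@raw_leq _ _ _ (i.+1 + (8 * j).+1)); first by lia.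
rewrite addnC; apply: raw_Seq; first exact: raw_goesL.
elim: j H0 => [|j IH] H0; first by rewrite muln0; apply: raw_While_false.
have -> : (8 * j.+1).+1 = (7 + (8 * j).+1).+1 by lia.
apply: raw_While_true; first by rewrite /= H0 //; lia.
- by rewrite mulnS addnC; apply: raw_goesL.
- by apply: IH => l Hl; apply: H0; lia.
Qed.

End Triples.

(** * Five stacks interleaved on one tape *)

Inductive reg := RD | RA | RB | RC | RF.

Record store := Store {
  s_D : seq bool; s_A : seq bool; s_B : seq bool; s_C : seq bool; s_F : seq bool;
  s_index : tape; s_out : seq bool }.

Definition get r s :=
  match r with RD => s_D s | RA => s_A s | RB => s_B s | RC => s_C s | RF => s_F s end.

Definition set r l s := let: Store d a b c f i o := s in
  match r with
  | RD => Store l a b c f i o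
  | RA => Store d l b c f i o
  | RB => Store d a l c f i o
  | RC => Store d a b l f i o
  | RF => Store d a b c l i o
  end.

Definition track_of r := match r with RD => 1 | RA => 2 | RB => 3 | RC => 4 | RF => 5 end.

(* Track 0 only marks the leftmost block; stacks grow to the right. *)
Definition track s i :=
  match i with
  | 0 => [:: true]
  | 1 => rev (s_D s)
  | 2 => rev (s_A s)
  | 3 => rev (s_B s)
  | 4 => rev (s_C s)
  | 5 => rev (s_F s)
  | _ => [::]
  end.

Definition wcell s p := nth None (map Some (track s (p %% width))) (p %/ width).

Definition abs s h := AState (wcell s) h (s_index s) (s_out s).

Definition hgt s := size (s_D s) + size (s_A s) + size (s_B s) + size (s_C s) + size (s_F s).

Lemma wcellE s r j : wcell s (track_of r + width * j) = nth None (map Some (rev (get r s))) j.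
Proof.
by rewrite /wcell addnC mulnC modnMDl divnMDl // divn_small ?addn0; case: r.
Qed.

Lemma wcell_mark s j : wcell s (width * j) = if j is 0 then Some true else None.
Proof. by rewrite /wcell mulnC modnMl mulnK //=; case: j => // -[]. Qed.

Lemma track_set r l s i :
  track (set r l s) i = if i == track_of r then rev l else track s i.
Proof. by case: s => d a b c f ti o; case: r; case: i => [|[|[|[|[|[|]]]]]]. Qed.

Lemma wcell_set r l s p :
  wcell (set r l s) p =
  if p %% width == track_of r then nth None (map Some (rev l)) (p %/ width) else wcell s p.
Proof. by rewrite /wcell track_set; case: ifP. Qed.

Lemma eq_cell r p j : (p == track_of r + width * j) =
  (p %% width == track_of r) && (p %/ width == j).
Proof.
have Hr : track_of r < width by case: r.
by rewrite {1}(divn_eq p width); move: (ltn_pmod p (isT : 0 < width)) Hr;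
  rewrite /width; lia.
Qed.

Lemma wcell_push r b l s p : get r s = l ->
  (if p == track_of r + width * size l then Some b else wcell s p) = wcell (set r (b :: l) s) p.
Proof.
move=> E; rewrite wcell_set eq_cell; case: eqP => //= Hp.
have -> : wcell s p = nth None (map Some (rev l)) (p %/ width).
  by rewrite -E -wcellE -Hp mulnC addnC -divn_eq.
rewrite rev_cons map_rcons nth_rcons size_map size_rev.
by case: ltngtP => //= H; rewrite nth_default // size_map size_rev ltnW.
Qed.

Lemma wcell_pop r b l s p : get r s = b :: l ->
  (if p == track_of r + width * size l then None else wcell s p) = wcell (set r l s) p.
Proof.
move=> E; rewrite wcell_set eq_cell; case: eqP => //= Hp.
have -> : wcell s p = nth None (map Some (rev (b :: l))) (p %/ width).
  by rewrite -E -wcellE -Hp mulnC addnC -divn_eq.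
rewrite rev_cons map_rcons nth_rcons size_map size_rev.
case: ltngtP => //= H; rewrite nth_default ?size_map ?size_rev ?H //. exact: ltnW.
Qed.

Lemma size_get r s : size (get r s) <= hgt s.
Proof. by case: s => *; case: r; rewrite /hgt /=; lia. Qed.

Lemma hgt_set r l s : hgt (set r l s) + size (get r s) = hgt s + size l.
Proof. by case: s => *; case: r; rewrite /hgt /=; lia. Qed.

Lemma index_set r l s : s_index (set r l s) = s_index s. Proof. by case: s; case: r. Qed.
Lemma out_set r l s : s_out (set r l s) = s_out s. Proof. by case: s; case: r. Qed.

Definition push r b :=
  Seq (goes MRight (track_of r)) (Seq scan (Seq (put (Some b)) (home (track_of r)))).

(** The popped bit survives only in the control, so the three continuations are arguments. Emptiness
    shows in the bottom cell of the track, without a scan. *)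
Definition popcase r ce c0 c1 :=
  Seq (goes MRight (track_of r))
    (If (fun v => v_work v == None)
       (Seq (goes MLeft (track_of r)) ce)
       (Seq scan (Seq (goes MLeft width)
          (If (fun v => v_work v == Some true)
             (Seq (put None) (Seq (home (track_of r)) c1))
             (Seq (put None) (Seq (home (track_of r)) c0)))))).

Definition whilene r c :=
  Seq (goes MRight (track_of r))
    (Seq (While (fun v => v_work v != None)
            (Seq (goes MLeft (track_of r)) (Seq c (goes MRight (track_of r)))))
         (goes MLeft (track_of r))).

(* One stack operation scans a track of height at most [hgt s + n]. *)
Definition exec X c s s' n :=
  hgt s' <= hgt s + n /\ exec_raw X c (abs s 0) (abs s' 0) (40 * n * (hgt s + n + 1)).

(** The loop of [whilene] with the head already on the bottom cell of track r, so that an induction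
    over the rounds does not repeat the approach. *)
Definition exec_while X r c s s' n :=
  hgt s' <= hgt s + n /\
  exec_raw X (While (fun v => v_work v != None)
            (Seq (goes MLeft (track_of r)) (Seq c (goes MRight (track_of r)))))
     (abs s (track_of r)) (abs s' (track_of r)) (40 * n * (hgt s + n + 1)).

Section Trip.
Variable X : input.

Lemma exec_leq c s s' n n' : n <= n' -> exec X c s s' n -> exec X c s s' n'.
Proof.
move=> l [h t]; split; first by lia.
by apply: raw_leq t; apply: leq_mul; lia.
Qed.

(** Budgets add up: the second command starts at height at most [hgt s + n], so the second factor of
    both quadratic time bounds is at most [hgt s + n + n' + 1]. *)
Lemma exec_Seq c d s s' s'' n n' :
  exec X c s s' n -> exec X d s' s'' n' -> exec X (Seq c d) s s'' (n + n').
Proof.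
move=> [h t] [h' t']; split; first by lia.
by apply: raw_leq (raw_Seq t t'); nia.
Qed.

Lemma nth_map_rev_neq (l : seq bool) j : j < size l -> nth None (map Some (rev l)) j != None.
Proof. by move=> H; rewrite (nth_map true) ?size_rev. Qed.

Lemma nth_map_rev_default (l : seq bool) : nth None (map Some (rev l)) (size l) = None.
Proof. by rewrite nth_default // size_map size_rev. Qed.

Lemma raw_scan_track r s : exec_raw X scan (abs s (track_of r))
  (abs s (track_of r + width * size (get r s))) (8 * size (get r s)).+1.
Proof.
rewrite -{1}[track_of r]addn0 -[in X in abs s X](muln0 width).
rewrite -{2}[size _]add0n; apply: raw_scan => [l Hl|]; rewrite !wcellE ?add0n.
- exact: nth_map_rev_neq.
- exact: nth_map_rev_default.
Qed.
Arguments raw_scan_track : clear implicits.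

Lemma raw_home_abs s r j :
  exec_raw X (home (track_of r)) (abs s (track_of r + width * j)) (abs s 0) (8 * j + 8).
Proof.
apply: (@raw_leq _ _ _ _ (track_of r + 8 * j + 2)); first by case: r => /=; lia.
apply: raw_home => [l Hl|].
- by rewrite wcell_mark; case: l Hl.
- by rewrite (wcell_mark s 0).
Qed.
Arguments raw_home_abs : clear implicits.

Lemma raw_enter s r : exec_raw X (goes MRight (track_of r)) (abs s 0) (abs s (track_of r)) 6.
Proof.
apply: (@raw_leq _ _ _ _ (track_of r).+1); first by case: r.
by have := @raw_goesR X (track_of r) (wcell s) 0 (s_index s) (s_out s); rewrite add0n.
Qed.
Arguments raw_enter : clear implicits.

Lemma raw_leave s r : exec_raw X (goes MLeft (track_of r)) (abs s (track_of r)) (abs s 0) 6.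
Proof.
apply: (@raw_leq _ _ _ _ (track_of r).+1); first by case: r.
by have := @raw_goesL X (track_of r) (wcell s) 0 (s_index s) (s_out s); rewrite add0n.
Qed.
Arguments raw_leave : clear implicits.

Lemma exec_push r b s : exec X (push r b) s (set r (b :: get r s) s) 1.
Proof.
split; first by have := hgt_set r (b :: get r s) s; rewrite /=; lia.
have := size_get r s; set n := size _ => Hn.
apply: (@raw_leq _ _ _ _ (6 + ((8 * n).+1 + (1 + (8 * n + 8))))); first by lia.
apply: raw_Seq (raw_enter _ _) _; apply: raw_Seq (raw_scan_track _ _) _.
apply: raw_Seq; last exact: raw_home_abs.
by rewrite /abs index_set out_set; apply: raw_put => p; apply: wcell_push.
Qed.

Lemma exec_pop_nil r ce c0 c1 s s' n : get r s = [::] ->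
  exec X ce s s' n -> exec X (popcase r ce c0 c1) s s' n.+1.
Proof.
move=> E [h t]; split; first by lia.
apply: (@raw_leq _ _ _ _ (6 + (6 + 40 * n * (hgt s + n + 1)).+1)); first by nia.
apply: raw_Seq (raw_enter _ _) _; apply: raw_If.
rewrite ifT; first exact: raw_Seq (raw_leave _ _) t.
by rewrite /=; have := wcellE s r 0; rewrite muln0 addn0 E => ->.
Qed.

Lemma exec_pop_cons r ce c0 c1 b l s s' n : get r s = b :: l ->
  exec X (if b then c1 else c0) (set r l s) s' n -> exec X (popcase r ce c0 c1) s s' n.+1.
Proof.
move=> E [h t]; have Hs := size_get r s; have Hh := hgt_set r l s.
rewrite E /= in Hs Hh; split; first by lia.
set m := size l in Hs Hh.
(* Besides the branch, a pop takes [16 * m + 33] raw steps: two traversals of the track and constant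
   overhead. One unit of budget grants at least [40 * (hgt s + 1)], and [hgt s] exceeds m. *)
apply: (@raw_leq _ _ _ _ (6 + ((8 * m.+1).+1 + (7 +
  (1 + (8 * m + 8 + 40 * n * (hgt (set r l s) + n + 1))).+1)).+1)).
  by move: Hs Hh; clear; nia.
apply: raw_Seq (raw_enter _ _) _; apply: raw_If; rewrite ifF; last first.
  by rewrite /=; have /= := wcellE s r 0; rewrite muln0 addn0 E => ->;
     apply/negbTE/nth_map_rev_neq.
have := raw_scan_track r s; rewrite E => Hscan.
apply: raw_Seq Hscan _.
apply: (@raw_Seq _ _ _ _ (abs s (track_of r + width * m))).
  have -> : track_of r + width * size (b :: l) = track_of r + width * m + width.
    by rewrite /m /=; lia.
  exact: raw_goesL.
apply: raw_If.
have -> : v_work (aview X (abs s (track_of r + width * m))) = Some b.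
  by rewrite /= wcellE E rev_cons map_rcons nth_rcons size_map size_rev ltnn eqxx.
have P : forall c n', exec_raw X c (abs (set r l s) 0) (abs s' 0) n' ->
    exec_raw X (Seq (put None) (Seq (home (track_of r)) c)) (abs s (track_of r + width * m))
      (abs s' 0) (1 + (8 * m + 8 + n')).
  move=> c n' Hc; apply: (@raw_Seq _ _ _ _ (abs (set r l s) (track_of r + width * m))).
  - by rewrite /abs index_set out_set; apply: raw_put => p; apply: wcell_pop E.
  - exact: raw_Seq (raw_home_abs _ _ _) Hc.
by case: b t {E}; apply: P.
Qed.

Lemma exec_while_nil r c s : get r s = [::] -> exec_while X r c s s 1.
Proof.
move=> E; split; first by lia.
apply: (@raw_leq _ _ _ _ 1); first by nia.
apply: raw_While_false => /=.
by have := wcellE s r 0; rewrite muln0 addn0 E => ->.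
Qed.

Lemma exec_while_cons r c s s' s'' n n' : get r s != [::] -> exec X c s s' n ->
  exec_while X r c s' s'' n' -> exec_while X r c s s'' (n + n').+1.
Proof.
move=> E [h t] [h' t']; split; first by lia.
apply: (@raw_leq _ _ _ _ (6 + (40 * n * (hgt s + n + 1) + 6) +
   40 * n' * (hgt s' + n' + 1)).+1); first by nia.
apply: raw_While_true t'.
  have /= := wcellE s r 0; rewrite muln0 addn0 => ->.
  by apply: nth_map_rev_neq; case: (get r s) E.
by apply: raw_Seq (raw_leave _ _) _; apply: raw_Seq t _; apply: raw_enter.
Qed.

Lemma exec_while_leq r c s s' n n' : n <= n' -> exec_while X r c s s' n ->
    exec_while X r c s s' n'.
Proof.
move=> l [h t]; split; first by lia.
by apply: raw_leq t; apply: leq_mul; lia.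
Qed.

Lemma exec_whilene r c s s' n : exec_while X r c s s' n -> exec X (whilene r c) s s' n.+1.
Proof.
move=> [h t]; split; first by lia.
apply: (@raw_leq _ _ _ _ (6 + (40 * n * (hgt s + n + 1) + 6))); first by nia.
by apply: raw_Seq (raw_enter _ _) _; apply: raw_Seq t _; apply: raw_leave.
Qed.

Definition skip := go MStay.

Lemma exec_skip s : exec X skip s s 1.
Proof.
split; first by lia.
by apply: (@raw_leq _ _ _ _ 1); [nia | apply: (raw_go _ MStay)].
Qed.

Definition set_index ti s := let: Store d a b c f _ o := s in Store d a b c f ti o.
Definition put_index w d := Do (fun v => Act (v_work v) MStay w d None).

Lemma exec_put_index w d ti s : teq (tape_move (tape_write (s_index s) w) d) ti ->
  exec X (put_index w d) s (set_index ti s) 1.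
Proof.
case: s => dd a b c f ti' o /= E; split; first by rewrite /hgt /=; lia.
apply: (@raw_leq _ _ _ _ 1); first by nia.
by apply: raw_Do; split=> //= p; case: eqP => [->|].
Qed.

Definition emit b := Do (fun v => Act (v_work v) MStay (v_index v) MStay (Some b)).
Definition set_out o s := let: Store d a b c f ti _ := s in Store d a b c f ti o.

Lemma exec_emit b s : exec X (emit b) s (set_out (rcons (s_out s) b) s) 1.
Proof.
case: s => d a b' c f ti o /=; split; first by rewrite /hgt /=; lia.
apply: (@raw_leq _ _ _ _ 1); first by nia.
apply: raw_Do; split=> //=; first by move=> p /=; case: eqP => [->|].
exact: teq_rewrite.
Qed.

Definition query_at (i : nat) : option bool * bool := (nth None (map Some X.1) i, i < X.2).

Lemma exec_If_query (p : option bool * bool -> bool) c d s s' n :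
  exec X (if p (query_at (tape_value (s_index s))) then c else d) s s' n ->
  exec X (If (fun v => p (v_input v, v_param v)) c d) s s' n.+1.
Proof.
move=> [h t]; split; first by lia.
by apply: (@raw_leq _ _ _ _ (40 * n * (hgt s + n + 1)).+1); [nia | exact: raw_If].
Qed.

End Trip.

(** * Binary trees on a stack *)

Inductive tree := tnil | tcons (a b : tree).

Fixpoint enc t := if t is tcons a b then true :: enc a ++ enc b else [:: false].
Definition tsz t := size (enc t).
Definition thd t := if t is tcons a _ then a else tnil.
Definition ttl t := if t is tcons _ b then b else tnil.

Lemma tsz_cons a b : tsz (tcons a b) = (tsz a + tsz b).+1.
Proof. by rewrite /tsz /= size_cat. Qed.

Lemma tsz_gt0 t : 0 < tsz t. Proof. by case: t. Qed.

(** The preorder code is prefix-free, so the top tree of a stack ends where its own bits say,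
    whatever lies below. *)
Lemma enc_prefix t t' d d' : enc t ++ d = enc t' ++ d' -> t = t' /\ d = d'.
Proof.
elim: t t' d d' => [|a IHa b IHb] [|a' b'] d d' //=; first by case.
by case; rewrite -!catA => /IHa[-> /IHb[-> ->]].
Qed.

Lemma enc_inj : injective enc.
Proof. by move=> t t' E; have [] := @enc_prefix t t' [::] [::] (congr1 (cat^~ [::]) E). Qed.

Definition teqb t t' := enc t == enc t'.
Lemma teqbP t t' : reflect (t = t') (teqb t t').
Proof. by apply: (iffP eqP) => [/enc_inj|->]. Qed.

Definition on_D d o := Store d [::] [::] [::] [::] empty_tape o.

Definition aux (z : bool) := if z then RA else RB.

(** Stack C counts in unary the subtrees still to be read: a [true] bit replaces one of them by two,
    a [false] bit completes one. The loop ends exactly at the end of the tree. *)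
Definition movetree z :=
  Seq (push RC true) (whilene RC (popcase RD skip
    (Seq (push (aux z) false) (popcase RC skip skip skip))
    (Seq (push (aux z) true) (push RC true)))).

Definition moveall r r' :=
  whilene r (popcase r skip (push r' false) (push r' true)).

Definition clear r := whilene r (popcase r skip skip skip).

Definition drop_tree := Seq (movetree true) (clear RA).

Definition dup :=
  Seq (movetree true)
    (Seq (whilene RA (popcase RA skip (Seq (push RD false) (push RB false))
                                      (Seq (push RD true) (push RB true))))
    (Seq (moveall RB RA) (moveall RA RD))).

Definition swap :=
  Seq (movetree true) (Seq (movetree false) (Seq (moveall RA RD) (moveall RB RD))).

Fixpoint pushes l := if l is b :: l' then Seq (pushes l') (push RD b) else skip.

Lemma get_set r l s : get r (set r l s) = l. Proof. by case: s; case: r. Qed.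

Lemma get_set_neq r r' l s : r <> r' -> get r (set r' l s) = get r s.
Proof. by case: s; case: r; case: r'. Qed.

Lemma set_set r l l' s : set r l (set r l' s) = set r l s. Proof. by case: s; case: r. Qed.

Lemma set_setC r r' l l' s : r <> r' -> set r l (set r' l' s) = set r' l' (set r l s).
Proof. by case: s; case: r; case: r'. Qed.

Section TreeOps.
Variable X : input.

Lemma exec_pop_drop r b l s : get r s = b :: l ->
  exec X (popcase r skip skip skip) s (set r l s) 2.
Proof.
by move=> E; apply: (exec_pop_cons _ E); case: b {E}; apply: exec_skip.
Qed.

Lemma exec_push_eq r b s s' : set r (b :: get r s) s = s' -> exec X (push r b) s s' 1.
Proof. by move=> <-; apply: exec_push. Qed.

Lemma exec_movetree z t d a b f ti o xs :
  exec X (movetree z) (set (aux z) xs (Store (enc t ++ d) a b [::] f ti o))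
    (set (aux z) (rev (enc t) ++ xs) (Store d a b [::] f ti o)) (5 * tsz t + 3).
Proof.
have -> : 5 * tsz t + 3 = 1 + (1 + 5 * tsz t).+1 by lia.
apply: (@exec_Seq _ _ _ _ (set (aux z) xs (Store (enc t ++ d) a b [:: true] f ti o))).
  by apply: exec_push_eq; case: z.
apply: exec_whilene; set body := popcase _ _ _ _.
(* The invariant is stated for an arbitrary remainder of the loop: after the left subtree the same
   loop goes on with the right one. *)
suff H s' n cs : exec_while X RC body (set (aux z) (rev (enc t) ++ xs) (Store d a b cs f ti o))
    s' n ->
  exec_while X RC body (set (aux z) xs (Store (enc t ++ d) a b (true :: cs) f ti o)) s'
    (n + 5 * tsz t).
  apply: (H _ 1); apply: exec_while_nil; by clear; case: z.
elim: t d xs cs n => [|t1 IH1 t2 IH2] d xs cs n /= H.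
- apply: (@exec_while_leq _ _ _ _ _ (4 + n).+1); first by rewrite /tsz /=; lia.
  apply: exec_while_cons H; first by clear; case: z.
  apply: (@exec_pop_cons _ _ _ _ _ false (d)); first by clear; case: z.
  have -> : 3 = 1 + 2 by [].
  apply: exec_Seq; first exact: exec_push.
  by clear; case: z; apply: exec_pop_drop.
- apply: (@exec_while_leq _ _ _ _ _ (3 + (n + 5 * tsz t2 + 5 * tsz t1)).+1).
    by rewrite tsz_cons; lia.
  apply: (@exec_while_cons _ _ _ _ (set (aux z) (true :: xs) (Store (enc t1 ++ (enc t2 ++ d)) a b
     [:: true, true & cs] f ti o))); first by clear; case: z.
    apply: (@exec_pop_cons _ _ _ _ _ true ((enc t1 ++ enc t2) ++ d)); first by clear; case: z.
    have -> : 2 = 1 + 1 by [].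
    apply: exec_Seq; first exact: exec_push.
    by clear; rewrite -catA; case: z; apply: exec_push_eq.
  apply: IH1; apply: IH2; move: H.
  by rewrite rev_cons rev_cat -cats1 -!catA.
Qed.

Lemma exec_to c s s' s'' n : s' = s'' -> exec X c s s'' n -> exec X c s s' n.
Proof. by move->. Qed.

Lemma exec_clear r s : exec X (clear r) s (set r [::] s) (3 * size (get r s) + 2).
Proof.
have -> : 3 * size (get r s) + 2 = (3 * size (get r s) + 1).+1 by lia.
apply: exec_whilene; move E: (get r s) => l.
elim: l s E => [|b l IH] s E.
  have -> : set r [::] s = s by case: s E => d a b' c f ti o; case: r => /= ->.
  exact: exec_while_nil.
have -> : 3 * size (b :: l) + 1 = (2 + (3 * size l + 1)).+1 by rewrite /=; lia.
apply: exec_while_cons; [by rewrite E | exact: exec_pop_drop E |].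
by rewrite -(set_set r [::] l); apply: IH; rewrite get_set.
Qed.

Lemma exec_moveall r r' s : r <> r' ->
  exec X (moveall r r') s (set r' (rev (get r s) ++ get r' s) (set r [::] s))
    (3 * size (get r s) + 2).
Proof.
move=> N.
have -> : 3 * size (get r s) + 2 = (3 * size (get r s) + 1).+1 by lia.
apply: exec_whilene; move E: (get r s) => l.
elim: l s E => [|b l IH] s E.
  have -> : set r' (rev [::] ++ get r' s) (set r [::] s) = s.
    by case: s E => d a b' c f ti o; case: r N => N /= ->; case: r' N.
  exact: exec_while_nil.
have -> : 3 * size (b :: l) + 1 = (2 + (3 * size l + 1)).+1 by rewrite /=; lia.
apply: (@exec_while_cons _ _ _ _ (set r' (b :: get r' s) (set r l s))); first by rewrite E.
  apply: (exec_pop_cons _ E).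
  have -> : get r' s = get r' (set r l s).
    by rewrite get_set_neq // => E'; case: N.
  by case: b {E}; apply: exec_push.
have -> : set r' (rev (b :: l) ++ get r' s) (set r [::] s) =
    set r' (rev l ++ get r' (set r' (b :: get r' s) (set r l s)))
      (set r [::] (set r' (b :: get r' s) (set r l s))).
  rewrite rev_cons cat_rcons.
  by rewrite get_set (set_setC _ _ _ N) !set_set.
by apply: IH; rewrite get_set_neq ?get_set // => E'; case: N.
Qed.

Lemma exec_drop_tree t d b f ti o :
  exec X drop_tree (Store (enc t ++ d) [::] b [::] f ti o) (Store d [::] b [::] f ti o)
    (13 * tsz t).
Proof.
have := tsz_gt0 t => t0.
eapply exec_leq; last first.
  apply: exec_Seq; first exact: (exec_movetree true t d [::] b f ti o [::]).
  exact: exec_clear.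
by rewrite /= cats0 size_rev -/(tsz t); lia.
Qed.

Lemma exec_dup t d o :
  exec X dup (on_D (enc t ++ d) o) (on_D (enc t ++ enc t ++ d) o) (30 * tsz t).
Proof.
have := tsz_gt0 t => t0.
eapply exec_leq; last first.
  apply: exec_Seq; first exact: (exec_movetree true t d [::] [::] [::] empty_tape o [::]).
  apply: (@exec_Seq _ _ _ _ (Store (enc t ++ d) [::] (enc t) [::] [::] empty_tape o) _
           (4 * tsz t + 2)).
    rewrite addn2; apply: exec_whilene; rewrite /= cats0; set body := popcase _ _ _ _.
    have H l e d' : exec_while X RA body (Store d' l e [::] [::] empty_tape o)
        (Store (rev l ++ d') [::] (rev l ++ e) [::] [::] empty_tape o) (4 * size l).+1.
      elim: l e d' => [|b l IH] e d'; first exact: exec_while_nil.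
      apply: (@exec_while_leq _ _ _ _ _ (3 + (4 * size l).+1).+1); first by rewrite /=; lia.
      apply: (@exec_while_cons _ _ _ _ (Store (b :: d') l (b :: e) [::] [::] empty_tape o)) => //.
        apply: (@exec_pop_cons _ _ _ _ _ b l) => //.
        by case: b; apply: (@exec_Seq _ _ _ _ _ _ 1 1); exact: exec_push.
      by rewrite rev_cons !cat_rcons; exact: IH.
    by have := H (rev (enc t)) [::] d; rewrite revK cats0 size_rev.
  apply: exec_Seq; first exact: exec_moveall.
  apply: exec_to (exec_moveall _ _) => //.
  by rewrite /= !cats0 revK.
by rewrite /= cats0 !size_rev -/(tsz t); lia.
Qed.

Lemma exec_swap t t' d o :
  exec X swap (on_D (enc t ++ enc t' ++ d) o) (on_D (enc t' ++ enc t ++ d) o)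
    (16 * (tsz t + tsz t')).
Proof.
have := tsz_gt0 t => t0; have := tsz_gt0 t' => t0'.
eapply exec_leq; last first.
  apply: exec_Seq; first exact: (exec_movetree true t _ [::] [::] [::] empty_tape o [::]).
  apply: exec_Seq.
    exact: (exec_movetree false t' d (rev (enc t) ++ [::]) [::] [::] empty_tape o [::]).
  apply: exec_Seq; first exact: exec_moveall.
  apply: exec_to (exec_moveall _ _) => //.
  by rewrite /= !cats0 !revK.
by rewrite /= !cats0 !size_rev -/(tsz t) -/(tsz t'); lia.
Qed.

Lemma exec_pushes l d o : exec X (pushes l) (on_D d o) (on_D (l ++ d) o) (size l).+1.
Proof.
elim: l => [|b l IH] /=; first exact: exec_skip.
by rewrite -addn1; apply: exec_Seq IH _; apply: exec_push_eq.
Qed.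

Definition if_tree c0 c1 :=
  popcase RD skip c0 (Seq (push RD true) (Seq drop_tree c1)).

Lemma exec_if_tree t c0 c1 d o s' n :
  exec X (if t is tnil then c0 else c1) (on_D d o) s' n ->
  exec X (if_tree c0 c1) (on_D (enc t ++ d) o) s' (n + 15 * tsz t).
Proof.
move=> H; case: t H => [|a b] H.
  apply: (@exec_leq _ _ _ _ n.+1); first by rewrite /tsz /=; lia.
  exact: (@exec_pop_cons _ _ _ _ _ false d).
apply: (@exec_leq _ _ _ _ (1 + (13 * tsz (tcons a b) + n)).+1).
  by rewrite tsz_cons; lia.
apply: (@exec_pop_cons _ _ _ _ _ true ((enc a ++ enc b) ++ d)) => //.
apply: exec_Seq; first exact: exec_push.
apply: exec_Seq H; exact: (exec_drop_tree (tcons a b)).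
Qed.

Definition hd_tree :=
  popcase RD skip (push RD false)
    (Seq (movetree true) (Seq (movetree false) (Seq (clear RB) (moveall RA RD)))).

Lemma exec_hd_tree t d o :
  exec X hd_tree (on_D (enc t ++ d) o) (on_D (enc (thd t) ++ d) o) (20 * tsz t).
Proof.
case: t => [|a b].
  apply: (@exec_leq _ _ _ _ 2) => //.
  apply: (@exec_pop_cons _ _ _ _ _ false d) => //; exact: exec_push.
have := tsz_gt0 a => a0; have := tsz_gt0 b => b0.
eapply exec_leq; last first.
  apply: (@exec_pop_cons _ _ _ _ _ true ((enc a ++ enc b) ++ d)) => //.
  rewrite -catA.
  apply: exec_Seq; first exact: (exec_movetree true a _ [::] [::] [::] empty_tape o [::]).
  apply: exec_Seq.
    exact: (exec_movetree false b d (rev (enc a) ++ [::]) [::] [::] empty_tape o [::]).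
  apply: exec_Seq; first exact: exec_clear.
  apply: exec_to (exec_moveall _ _) => //.
  by rewrite /= !cats0 !revK.
by rewrite tsz_cons /= !cats0 !size_rev -/(tsz a) -/(tsz b); lia.
Qed.

Definition tl_tree := popcase RD skip (push RD false) drop_tree.

Lemma exec_tl_tree t d o :
  exec X tl_tree (on_D (enc t ++ d) o) (on_D (enc (ttl t) ++ d) o) (20 * tsz t).
Proof.
case: t => [|a b].
  apply: (@exec_leq _ _ _ _ 2) => //.
  apply: (@exec_pop_cons _ _ _ _ _ false d) => //; exact: exec_push.
apply: (@exec_leq _ _ _ _ (13 * tsz a).+1); first by rewrite tsz_cons; lia.
apply: (@exec_pop_cons _ _ _ _ _ true ((enc a ++ enc b) ++ d)) => //.
by rewrite -catA; apply: exec_drop_tree.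
Qed.

Definition tbool (b : bool) := if b then tcons tnil tnil else tnil.

Definition mark := push RC true.

(* A mismatch is recorded by a nonempty stack C. *)
Definition eq_tree :=
  Seq (movetree true) (Seq (movetree false)
  (Seq (Seq (whilene RA (popcase RA skip (popcase RB mark skip mark) (popcase RB mark mark skip)))
            (whilene RB (popcase RB skip mark mark)))
  (popcase RC (pushes (enc (tbool true)))
     (Seq (clear RC) (pushes (enc (tbool false))))
     (Seq (clear RC) (pushes (enc (tbool false))))))).

Lemma exec_compare (l l' cs d o : seq bool) : exists2 cs' : seq bool,
  (cs' == [::]) = (cs == [::]) && (l == l') &
  exec X (Seq (whilene RA (popcase RA skip (popcase RB mark skip mark) (popcase RB mark mark
      skip)))
     (whilene RB (popcase RB skip mark mark)))
    (Store d l l' cs [::] empty_tape o) (Store d [::] [::] cs' [::] empty_tape o)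
    (4 * size l + 3 * size l' + 4) /\ size cs' <= size cs + size l + size l'.
Proof.
set body := popcase RA _ _ _; set body' := popcase RB _ _ _.
(* [H2] treats what is left on B once A is exhausted: every surplus bit becomes a mark. [H1] treats
   the loop over A and hands over that surplus. *)
have H2 (r' cs0 : seq bool) : exists cs' : seq bool,
    [/\ (cs' == [::]) = (cs0 == [::]) && (r' == [::]),
    exec_while X RB body' (Store d [::] r' cs0 [::] empty_tape o)
      (Store d [::] [::] cs' [::] empty_tape o) (3 * size r').+1 &
    size cs' <= size cs0 + size r'].
  elim: r' cs0 => [|b r' IH] cs0.
    by exists cs0; split; [rewrite andbT | exact: exec_while_nil | rewrite addn0].
  have [cs' [E W S]] := IH (true :: cs0); exists cs'; split.
  - by rewrite E /= andbF.
  - apply: (@exec_while_leq _ _ _ _ _ (2 + (3 * size r').+1).+1); first by rewrite /=; lia.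
    apply: exec_while_cons W => //.
    by apply: (@exec_pop_cons _ _ _ _ _ b r') => //; case: b; apply: exec_push.
  - by move: S => /=; lia.
have H1 : exists r' cs' : seq bool, [/\ (cs' == [::]) && (r' == [::]) = (cs == [::]) && (l == l'),
    exec_while X RA body (Store d l l' cs [::] empty_tape o)
      (Store d [::] r' cs' [::] empty_tape o) (4 * size l).+1,
    size r' <= size l' & size cs' + size r' <= size cs + size l + size l'].
  elim: l l' cs => [|b l IH] l' cs.
    exists l', cs; split=> //; [by rewrite (eq_sym l') | exact: exec_while_nil|lia].
  case: l' => [|b' l'].
    have [r' [cs' [E W S S']]] := IH [::] (true :: cs); exists r', cs'; split=> //.
    - by rewrite E andbF.
    - apply: (@exec_while_leq _ _ _ _ _ (3 + (4 * size l).+1).+1); first by rewrite /=; lia.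
      apply: exec_while_cons W => //.
      apply: (@exec_pop_cons _ _ _ _ _ b l) => //.
      by clear; case: b; apply: exec_pop_nil => //; apply: exec_push.
    - by move: S' => /=; lia.
  have [r' [cs' [E W S S']]] := IH l' (if b == b' then cs else true :: cs).
  exists r', cs'; split=> //=.
  - by rewrite E eqseq_cons; case: (b == b'); rewrite //= andbF.
  - apply: (@exec_while_leq _ _ _ _ _ (3 + (4 * size l).+1).+1); first by rewrite /=; lia.
    apply: exec_while_cons W => //.
    apply: (@exec_pop_cons _ _ _ _ _ b l) => //.
    clear; case: b; apply: (@exec_pop_cons _ _ _ _ _ b' l') => //;
      case: b' => /=; try exact: exec_skip; exact: exec_push.
  - by lia.
  - by move: S'; case: ifP => _ /=; lia.
have [r' [cs1 [E1 W1 S1 S1']]] := H1; have [cs' [E2 W2 S2]] := H2 r' cs1.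
exists cs'; first by rewrite E2 E1.
split; last by lia.
eapply exec_leq; last by apply: exec_Seq; apply: exec_whilene; [exact: W1 | exact: W2].
by lia.
Qed.

Lemma exec_eq_tree a b d o :
  exec X eq_tree (on_D (enc a ++ enc b ++ d) o) (on_D (enc (tbool (teqb a b)) ++ d) o)
    (40 * (tsz a + tsz b)).
Proof.
have := tsz_gt0 a => a0; have := tsz_gt0 b => b0.
have [cs' E [W S]] := exec_compare (rev (enc a)) (rev (enc b)) [::] d o.
have {}E : (cs' == [::]) = teqb a b.
  by rewrite E /= (can_eq revK).
eapply exec_leq; last first.
  apply: exec_Seq; first exact: (exec_movetree true a _ [::] [::] [::] empty_tape o [::]).
  apply: exec_Seq.
    exact: (exec_movetree false b d (rev (enc a) ++ [::]) [::] [::] empty_tape o [::]).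
  apply: exec_Seq; first by rewrite /= !cats0; exact: W.
  case: cs' E {W} S => [|c cs'] <- S.
    apply: exec_pop_nil => //; apply: (@exec_leq _ _ _ _ 4 (3 * size (rev (enc a)) + 3 * size
        (rev (enc b)) + 8)).
      by lia.
    exact: (exec_pushes [:: true; false; false]).
  apply: (@exec_pop_cons _ _ _ _ _ c cs') => //.
  apply: (@exec_leq _ _ _ _ (3 * size cs' + 2 + 2)); first by move: S => /=; lia.
  case: c {S}; (apply: exec_Seq; [exact: exec_clear | exact: (exec_pushes [:: false])]).
by rewrite !size_rev -/(tsz a) -/(tsz b); lia.
Qed.

End TreeOps.

(* A cell [c] stands for the digit 1 iff [thd c] is not [tnil]. *)
Fixpoint tcells (t : tree) : seq (option bool) :=
  if t is tcons c t' then (if thd c is tnil then None else Some true) :: tcells t' else [::].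

Definition tcell (c : option bool) : tree :=
  if c is Some b then tcons (tbool b) tnil else tnil.

Definition tanswer (r : option bool * bool) := tcons (tcell r.1) (tbool r.2).

Definition query (X : input) (t : tree) : tree :=
  tanswer (query_at X (tape_value (Tape (tcells t) 0))).

Definition go_index d := Do (fun v => Act (v_work v) MStay (v_index v) d None).

(** The mark on B records the written digit, so that [erase_index] can restore the blank index tape
    demanded by [on_D]. The mark on F keeps the loop running. *)
Definition store_digit w := Seq (put_index w MRight) (Seq (push RB true) (push RF true)).

Definition write_index :=
  Seq (push RF true) (whilene RF (Seq (popcase RF skip skip skip)
    (popcase RD skip skip
      (popcase RD skip (store_digit None)
        (popcase RD skip
          (Seq (pushes [:: true; false]) (Seq drop_tree (store_digit None)))
          (Seq (pushes [:: true; true]) (Seq drop_tree (store_digit (Some true))))))))).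

Definition erase_index :=
  whilene RB (Seq (popcase RB skip skip skip) (Seq (go_index MLeft) (put_index None MStay))).

(** The addressed input bit is visible only to a test, so it is compared with each of the six
    possible answers in turn. *)
Fixpoint push_answer vs :=
  if vs is r :: vs' then
    If (fun v => (fun p => p == r) (v_input v, v_param v)) (pushes (enc (tanswer r)))
        (push_answer vs')
  else skip.

Definition answers := [seq (c, b) | c <- [:: None; Some false; Some true], b <- [:: false; true]].

Definition query_tree := Seq write_index (Seq (push_answer answers) erase_index).

Section Query.
Variable X : input.

Lemma exec_go_index d ti s : teq (tape_move (s_index s) d) ti ->
  exec X (go_index d) s (set_index ti s) 1.
Proof.
case: s => dd a b c f ti' o /= [E E']; split; first by rewrite /hgt /=; lia.
apply: (@raw_leq _ _ _ _ 1); first by nia.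
apply: raw_Do; split=> //=; first by move=> p; case: eqP => [->|].
have [_ H] := teq_rewrite ti'; split=> [|p]; first exact: E.
exact: etrans (H p) (E' p).
Qed.

Lemma exec_pushes_at l d a b c f ti o :
  exec X (pushes l) (Store d a b c f ti o) (Store (l ++ d) a b c f ti o) (size l).+1.
Proof.
elim: l => [|x l IH] /=; first exact: exec_skip.
by rewrite -addn1; apply: exec_Seq IH _; apply: exec_push_eq.
Qed.

Lemma exec_store_digit w ws d b f o :
  exec X (store_digit w) (Store d [::] b [::] f (Tape ws (size ws)) o)
    (Store d [::] (true :: b) [::] (true :: f) (Tape (rcons ws w) (size ws).+1) o) 3.
Proof.
apply: (@exec_Seq _ _ _ _ _ _ 1 2).
  apply: (@exec_put_index _ _ _ (Tape (rcons ws w) (size ws).+1)); split=> //= p.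
  rewrite nth_set_nth /= nth_rcons; case: ltngtP => // H.
  by rewrite nth_default // ltnW.
by apply: (@exec_Seq _ _ _ _ _ _ 1 1); apply: exec_push_eq.
Qed.

Lemma exec_write_index t d o :
  exec X write_index (on_D (enc t ++ d) o)
    (Store d [::] (nseq (size (tcells t)) true) [::] [::]
       (Tape (tcells t) (size (tcells t))) o) (20 * tsz t + 10).
Proof.
apply: (@exec_leq _ _ _ _ (1 + (20 * tsz t + 5).+1)); first by lia.
apply: (@exec_Seq _ _ _ _ (Store (enc t ++ d) [::] [::] [::] [:: true] empty_tape o)).
  exact: exec_push_eq.
apply: exec_whilene; set body := Seq _ _.
suff H ws : exec_while X RF body
    (Store (enc t ++ d) [::] (nseq (size ws) true) [::] [:: true] (Tape ws (size ws)) o)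
    (Store d [::] (nseq (size (ws ++ tcells t)) true) [::] [::]
      (Tape (ws ++ tcells t) (size (ws ++ tcells t))) o) (20 * tsz t + 5).
  exact: (H [::]).
elim: t ws => [|c _ t IH] ws.
  apply: (@exec_while_leq _ _ _ _ _ (4 + 1).+1); first by [].
  apply: exec_while_cons; last 1 first.
  - exact: exec_while_nil.
  - by [].
  apply: (@exec_Seq _ _ _ _ _ _ 2 2).
    exact: (@exec_pop_drop _ RF true [::]).
  rewrite cats0; apply: (@exec_pop_cons _ _ _ _ _ false d) => //; exact: exec_skip.
pose w := if thd c is tnil then None else Some true : option bool.
apply: (@exec_while_leq _ _ _ _ _ ((2 + 20 * tsz c) + (20 * tsz t + 5)).+1).
  by rewrite tsz_cons; lia.
have -> : ws ++ tcells (tcons c t) = rcons ws w ++ tcells t by rewrite cat_rcons.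
apply: exec_while_cons (IH _) => //.
apply: exec_Seq; first exact: (@exec_pop_drop _ RF true [::]).
rewrite size_rcons /=.
have := tsz_gt0 c; case: c @w {IH} => [|a b] w Hc.
  apply: (@exec_leq _ _ _ _ 5) => //.
  apply: (@exec_pop_cons _ _ _ _ _ true (enc tnil ++ enc t ++ d)) => //.
  apply: (@exec_pop_cons _ _ _ _ _ false (enc t ++ d)) => //.
  exact: exec_store_digit.
have E : (enc (tcons a b) ++ enc t) ++ d = true :: enc a ++ (enc b ++ (enc t ++ d)).
  by rewrite /= -!catA.
have W : w = (if a is tnil then None else Some true) by [].
apply: (@exec_leq _ _ _ _ (13 * tsz (tcons a b) + 9)).
  by rewrite tsz_cons; have := tsz_gt0 a; have := tsz_gt0 b; lia.
rewrite addnS; apply: (@exec_pop_cons _ _ _ _ _ true (true :: enc a ++ (enc b ++ (enc t ++ d)))).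
  by rewrite -E.
rewrite addnS; apply: (@exec_pop_cons _ _ _ _ _ true (enc a ++ (enc b ++ (enc t ++ d)))) => //.
rewrite W; case: a {Hc W w} E => [|a1 a2] E.
- rewrite addnS; apply: (@exec_pop_cons _ _ _ _ _ false (enc b ++ (enc t ++ d))) => //.
  rewrite (_ : 13 * _ + 6 = 3 + (13 * tsz (tcons tnil b) + 3)); last by lia.
  apply: exec_Seq; first exact: (exec_pushes_at [:: true; false]).
  rewrite -[_ ++ _]/((true :: enc tnil ++ enc b ++ enc t ++ d)) -E -catA.
  by apply: exec_Seq; [exact: exec_drop_tree | exact: exec_store_digit].
- rewrite addnS; apply: (@exec_pop_cons _ _ _ _ _ true ((enc a1 ++ enc a2) ++ (enc b ++ (enc t ++
    d)))) => //.
  rewrite (_ : 13 * _ + 6 = 3 + (13 * tsz (tcons (tcons a1 a2) b) + 3)); last by lia.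
  apply: exec_Seq; first exact: (exec_pushes_at [:: true; true]).
  rewrite -[[:: true; true] ++ _]/((true :: enc (tcons a1 a2) ++ enc b ++ enc t ++ d)) -E -catA.
  by apply: exec_Seq; [exact: exec_drop_tree | exact: exec_store_digit].
Qed.

Lemma exec_erase_index ws d o :
  exec X erase_index (Store d [::] (nseq (size ws) true) [::] [::] (Tape ws (size ws)) o)
    (on_D d o) (5 * size ws + 2).
Proof.
rewrite addnS; apply: exec_whilene.
elim/last_ind: ws => [|ws w IH]; first exact: exec_while_nil.
apply: (@exec_while_leq _ _ _ _ _ (4 + (5 * size ws + 1)).+1); first by rewrite size_rcons; lia.
apply: exec_while_cons IH; first by rewrite size_rcons.
rewrite size_rcons; apply: (@exec_Seq _ _ _ _ _ _ 2 2).
  exact: (@exec_pop_drop _ RB true (nseq (size ws) true)).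
apply: (@exec_Seq _ _ _ _ _ _ 1 1).
  exact: (@exec_go_index _ (Tape (rcons ws w) (size ws))).
apply: (@exec_put_index _ _ _ (Tape ws (size ws))); split=> //= p.
rewrite nth_set_nth /= nth_rcons; case: ltngtP => // H; first by rewrite nth_default // ltnW.
by rewrite nth_default ?H.
Qed.

Lemma exec_push_answer d a b c f ti o :
  exec X (push_answer answers) (Store d a b c f ti o)
    (Store (enc (tanswer (query_at X (tape_value ti))) ++ d) a b c f ti o) 20.
Proof.
set r := query_at X _; have Hr : r \in answers by case: r => [[[]|] []].
have L : size answers <= 6 by [].
apply: (@exec_leq _ _ _ _ (14 + size answers)); first by [].
elim: answers Hr {L} => //= r' rs IH; rewrite inE => Hr.
rewrite addnS; apply: (@exec_If_query _ (fun p => p == r')).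
rewrite -/r; case: eqP Hr => [<- _|_ /= /IH //].
apply: exec_leq; last exact: (exec_pushes_at (enc (tanswer r))).
by case: r {IH} => [[[]|] []] /=; lia.
Qed.

Lemma size_tcells t : size (tcells t) <= tsz t.
Proof. by elim: t => //= a _ b IH; rewrite tsz_cons; lia. Qed.

Lemma exec_query_tree t d o :
  exec X query_tree (on_D (enc t ++ d) o) (on_D (enc (query X t) ++ d) o) (60 * tsz t).
Proof.
apply: (@exec_leq _ _ _ _ ((20 * tsz t + 10) + (20 + (5 * size (tcells t) + 2)))).
  by have := size_tcells t; have := tsz_gt0 t; lia.
apply: exec_Seq; first exact: exec_write_index.
by apply: exec_Seq; [exact: exec_push_answer | exact: exec_erase_index].
Qed.

End Query.

(** * Polynomial-time functions on trees *)

(** The base is at least 2, so the exponent alone absorbs constants, sums and products. *)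
Definition polybounded (g : nat -> nat) := exists k, forall n, g n <= (n + 2) ^ k.

Lemma polybounded_leq g g' : (forall n, g n <= g' n) -> polybounded g' -> polybounded g.
Proof. by move=> H [k Hk]; exists k => n; apply: leq_trans (Hk n). Qed.

Lemma polybounded_id : polybounded id. Proof. by exists 1 => n; rewrite expn1 leq_addr. Qed.

Lemma leq_expn2r m n k : m <= n -> m ^ k <= n ^ k.
Proof. by case: k => // k; rewrite leq_exp2r. Qed.

Lemma polybounded_const c : polybounded (fun=> c).
Proof.
exists c => n; apply: (@leq_trans (2 ^ c)); first by rewrite ltnW // ltn_expl.
by apply: leq_expn2r; lia.
Qed.

Lemma polybounded_add g g' : polybounded g -> polybounded g' -> polybounded (fun n => g n + g' n).
Proof.
move=> [k Hk] [k' Hk']; exists (k + k').+1 => n.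
have := Hk n; have := Hk' n; rewrite expnS expnD.
have : 0 < (n + 2) ^ k by rewrite expn_gt0 addn2.
have : 0 < (n + 2) ^ k' by rewrite expn_gt0 addn2.
by move: (_ ^ k) (_ ^ k') => a b; nia.
Qed.

Lemma polybounded_mul g g' : polybounded g -> polybounded g' -> polybounded (fun n => g n * g' n).
Proof.
by move=> [k Hk] [k' Hk']; exists (k + k') => n; rewrite expnD leq_mul.
Qed.

Lemma polybounded_exp g k : polybounded g -> polybounded (fun n => g n ^ k).
Proof. by move=> [k' H]; exists (k' * k) => n; rewrite expnM; apply: leq_expn2r. Qed.

Lemma polybounded_comp g g' : polybounded g -> polybounded g' -> polybounded (fun n => g (g' n)).
Proof.
move=> [k Hk] H'; apply: (@polybounded_leq _ (fun n => (g' n + 2) ^ k)) => //.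
by apply: polybounded_exp; apply: polybounded_add H' (polybounded_const 2).
Qed.

(* The argument on top of stack D is replaced by the value; everything below it is untouched. *)
Definition realizes c (f : input -> tree -> tree) (g : nat -> nat) :=
  forall X t d o, exec X c (on_D (enc t ++ d) o) (on_D (enc (f X t) ++ d) o) (g (tsz t)).

Definition polytime (f : input -> tree -> tree) := exists c k,
    realizes c f (fun n => (n + 2) ^ k).

Lemma polytime_intro c f g : polybounded g -> realizes c f g -> polytime f.
Proof.
by move=> [k Hk] H; exists c, k => X t d o; apply: exec_leq (Hk _) (H X t d o).
Qed.

(** The size bound on values is already part of [exec]: with nothing else on the stacks, the final
    height is the size of the value. The summand n stands for the initial height. *)
Lemma polytime_elim f : polytime f -> exists c g, [/\ polybounded g, {homo g : m n / m <= n},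
  realizes c f g & forall X t, tsz (f X t) <= g (tsz t)].
Proof.
move=> [c [k H]]; exists c, (fun n => n + (n + 2) ^ k); split.
- by apply: polybounded_add polybounded_id _; exists k.
- by move=> m n le; rewrite leq_add ?leq_expn2r ?leq_add2r.
- by move=> X t d o; apply: exec_leq (H X t d o); apply: leq_addl.
- move=> X t; have [+ _] := H X t [::] [::].
  by rewrite /hgt /= !addn0 !cats0.
Qed.

Lemma polytime_ext f f' : (forall X t, f X t = f' X t) -> polytime f -> polytime f'.
Proof. by move=> E [c [k H]]; exists c, k => X t d o; rewrite -E. Qed.

Lemma polytime_id : polytime (fun _ t => t).
Proof.
apply: (@polytime_intro skip _ (fun=> 1)) => [|X t d o]; first exact: polybounded_const.
exact: exec_skip.
Qed.

Lemma polytime_comp f h : polytime f -> polytime h -> polytime (fun X t => h X (f X t)).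
Proof.
move=> /polytime_elim[c [g [Pg _ H S]]] /polytime_elim[c' [g' [Pg' M' H' _]]].
apply: (@polytime_intro (Seq c c') _ (fun n => g n + g' (g n))).
  exact: polybounded_add Pg (polybounded_comp Pg' Pg).
move=> X t d o; apply: exec_Seq (H X t d o) _.
by apply: exec_leq (H' X _ d o); apply: M'.
Qed.

Lemma polytime_nil : polytime (fun _ _ => tnil).
Proof.
apply: (@polytime_intro (Seq drop_tree (push RD false)) _ (fun n => 13 * n + 1)).
  exact: polybounded_add (polybounded_mul (polybounded_const _) polybounded_id)
      (polybounded_const _).
move=> X t d o; apply: exec_Seq; first exact: exec_drop_tree.
exact: exec_push.
Qed.

(** [dup] keeps a copy of the argument below the first call; one [swap] brings it up for the second
    call, and another restores the order of the two results. *)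
Lemma polytime_cons f h : polytime f -> polytime h -> polytime (fun X t => tcons (f X t) (h X t)).
Proof.
move=> /polytime_elim[c [g [Pg M H S]]] /polytime_elim[c' [g' [Pg' M' H' S']]].
apply: (@polytime_intro (Seq dup (Seq c (Seq swap (Seq c' (Seq swap (push RD true)))))) _
  (fun n => 30 * n + (g n + (16 * (g n + n) + (g' n + (16 * (g' n + g n) + 1)))))).
  by repeat first [exact: polybounded_const | exact: polybounded_id | exact: Pg | exact: Pg'
                  | apply: polybounded_add | apply: polybounded_mul].
move=> X t d o.
apply: exec_Seq (exec_dup _ _ _ _) _.
apply: exec_Seq (H _ _ _ _) _.
apply: exec_Seq; first by apply: exec_leq (exec_swap _ _ _ _ _); have := S X t; lia.
apply: exec_Seq (H' _ _ _ _) _.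
apply: exec_Seq.
  by apply: exec_leq (exec_swap _ _ _ _ _); have := S X t; have := S' X t; lia.
by rewrite /= -catA; apply: exec_push.
Qed.

Lemma polytime_hd f : polytime f -> polytime (fun X t => thd (f X t)).
Proof.
move=> Pf; apply: (@polytime_comp _ (fun _ => thd) Pf).
apply: (@polytime_intro hd_tree _ (fun n => 20 * n));
    first exact: polybounded_mul (polybounded_const _) polybounded_id.
by move=> X t d o; apply: exec_hd_tree.
Qed.

Lemma polytime_tl f : polytime f -> polytime (fun X t => ttl (f X t)).
Proof.
move=> Pf; apply: (@polytime_comp _ (fun _ => ttl) Pf).
apply: (@polytime_intro tl_tree _ (fun n => 20 * n));
    first exact: polybounded_mul (polybounded_const _) polybounded_id.
by move=> X t d o; apply: exec_tl_tree.
Qed.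

Lemma polytime_if f f0 f1 : polytime f -> polytime f0 -> polytime f1 ->
  polytime (fun X t => if f X t is tnil then f0 X t else f1 X t).
Proof.
move=> /polytime_elim[c [g [Pg M H S]]] /polytime_elim[c0 [g0 [Pg0 _ H0 _]]] /polytime_elim[c1
    [g1 [Pg1 _ H1 _]]].
apply: (@polytime_intro (Seq dup (Seq c (if_tree c0 c1))) _
   (fun n => 30 * n + (g n + (g0 n + g1 n + 15 * g n)))).
  by repeat first [exact: polybounded_const | exact: polybounded_id | assumption
                  | apply: polybounded_add | apply: polybounded_mul].
move=> X t d o.
apply: exec_Seq (exec_dup _ _ _ _) _.
apply: exec_Seq (H _ _ _ _) _.
apply: (@exec_leq _ _ _ _ (g0 (tsz t) + g1 (tsz t) + 15 * tsz (f X t))).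
  by have := S X t; lia.
apply: exec_if_tree; case: (f X t) => [|_ _].
- by apply: exec_leq (H0 X t d o); lia.
- by apply: exec_leq (H1 X t d o); lia.
Qed.

Lemma polytime_eq f h : polytime f -> polytime h -> polytime (fun X t => tbool (teqb (f X t) (h X
    t))).
Proof.
move=> Pf Ph.
apply: (@polytime_ext (fun X t => (fun _ p => tbool (teqb (thd p) (ttl p))) X
  (tcons (f X t) (h X t)))) => //.
apply: (@polytime_comp _ (fun _ p => tbool (teqb (thd p) (ttl p))) (polytime_cons Pf Ph)).
apply: (@polytime_intro (popcase RD skip (pushes (enc (tbool true))) eq_tree) _
   (fun n => 40 * n + 6)).
  exact: polybounded_add (polybounded_mul (polybounded_const _) polybounded_id)
      (polybounded_const _).
move=> X [|a b] d o.
  apply: (@exec_leq _ _ _ _ 5) => //.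
  apply: (@exec_pop_cons _ _ _ _ _ false d) => //.
  exact: (exec_pushes _ (enc (tbool true))).
apply: (@exec_leq _ _ _ _ (40 * (tsz a + tsz b)).+1); first by rewrite tsz_cons; lia.
apply: (@exec_pop_cons _ _ _ _ _ true ((enc a ++ enc b) ++ d)) => //.
by rewrite -catA; apply: exec_eq_tree.
Qed.

Lemma polytime_query f : polytime f -> polytime (fun X t => query X (f X t)).
Proof.
move=> Pf; apply: (@polytime_comp _ query Pf).
apply: (@polytime_intro query_tree _ (fun n => 60 * n));
    first exact: polybounded_mul (polybounded_const _) polybounded_id.
by move=> X t d o; apply: exec_query_tree.
Qed.

Lemma polytime_const t0 : polytime (fun _ _ => t0).
Proof. by elim: t0 => [|a IHa b IHb]; [exact: polytime_nil | exact: polytime_cons]. Qed.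

(* Repeats [c] on the top tree [y] while [thd y] is not [tnil];
    the loop flag is kept on stack F. *)
Definition twhile c :=
  Seq (push RF true) (whilene RF (Seq (popcase RF skip skip skip)
    (popcase RD skip (push RD false)
      (popcase RD skip
        (Seq (push RD false) (push RD true))
        (Seq (push RD true) (Seq (push RD true) (Seq c (push RF true)))))))).

Section While.
Variables (X : input) (c : cmd).

(** The loop flag on F is popped before the body and pushed again after it, so that c runs on a
    store of the form [on_D], the only form that [realizes] speaks about. *)
Definition exec_loop y d o s' n := exec_while X RF
  (Seq (popcase RF skip skip skip)
    (popcase RD skip (push RD false)
      (popcase RD skip
        (Seq (push RD false) (push RD true))
        (Seq (push RD true) (Seq (push RD true) (Seq c (push RF true)))))))
  (Store (enc y ++ d) [::] [::] [::] [:: true] empty_tape o) s' n.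

Lemma exec_loop_stop y d o : thd y = tnil -> exec_loop y d o (on_D (enc y ++ d) o) 10.
Proof.
move=> Hy; apply: (@exec_while_leq _ _ _ _ _ ((2 + 4) + 1).+1) => //.
apply: exec_while_cons; last 1 first.
- exact: exec_while_nil.
- by [].
apply: exec_Seq; first exact: (@exec_pop_drop _ RF true [::]).
case: y Hy => [_|a b /= ->].
  apply: (@exec_leq _ _ _ _ 2) => //.
  by apply: (@exec_pop_cons _ _ _ _ _ false d) => //; apply: exec_push.
apply: (@exec_pop_cons _ _ _ _ _ true (false :: enc b ++ d)) => //.
apply: (@exec_pop_cons _ _ _ _ _ false (enc b ++ d)) => //.
by apply: (@exec_Seq _ _ _ _ _ _ 1 1); apply: exec_push_eq.
Qed.

Lemma exec_loop_step y y' d o o' s' m n : thd y <> tnil ->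
  exec X c (on_D (enc y ++ d) o) (on_D (enc y' ++ d) o') m ->
  exec_loop y' d o' s' n -> exec_loop y d o s' (m + n + 10).
Proof.
move=> Hy H W; apply: (@exec_while_leq _ _ _ _ _ ((2 + (1 + (1 + (m + 1))).+2) + n).+1);
    first by lia.
apply: exec_while_cons W => //.
apply: exec_Seq; first exact: (@exec_pop_drop _ RF true [::]).
case: y Hy H => [//|[//|a1 a2] b] _ H.
apply: (@exec_pop_cons _ _ _ _ _ true ((enc (tcons a1 a2) ++ enc b) ++ d)) => //.
apply: (@exec_pop_cons _ _ _ _ _ true (((enc a1 ++ enc a2) ++ enc b) ++ d)) => //.
apply: exec_Seq; first exact: exec_push.
apply: exec_Seq; first exact: exec_push.
by apply: exec_Seq H _; apply: exec_push_eq.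
Qed.

Lemma exec_twhile y d o s' n :
  exec_loop y d o s' n -> exec X (twhile c) (on_D (enc y ++ d) o) s' (n + 2).
Proof.
move=> W; rewrite addn2 -[n.+2]add1n; apply: exec_Seq; last exact: exec_whilene W.
exact: exec_push_eq.
Qed.
End While.

(** * Folds over lists with controlled accumulators *)

Fixpoint tfold (h : tree -> tree) (l s e : tree) :=
  if l is tcons a l' then tfold h l' (h (tcons a (tcons s e))) e else s.

(* Additive growth keeps all intermediate accumulators of a fold polynomial. *)
Definition slow_growth (h : input -> tree -> tree) := exists k, forall X a s e,
  tsz (h X (tcons a (tcons s e))) <= tsz s + (tsz a + tsz e + 2) ^ k.

Lemma tsz_thd t : tsz (thd t) <= tsz t.
Proof. by case: t => // a b; rewrite tsz_cons /=; lia. Qed.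

Lemma tsz_ttl t : tsz (ttl t) <= tsz t.
Proof. by case: t => // a b; rewrite tsz_cons /=; lia. Qed.

Lemma polytime_fold h l s e : polytime h -> slow_growth h -> polytime l -> polytime s ->
    polytime e ->
  polytime (fun X t => tfold (h X) (l X t) (s X t) (e X t)).
Proof.
move=> Ph [k Hk] Pl Ps Pe.
(* The loop state holds the remaining list, the accumulator and the environment. The list is
   [thd y], so [twhile] stops when it is used up. *)
pose body X y := tcons (ttl (thd y))
  (tcons (h X (tcons (thd (thd y)) (ttl y))) (ttl (ttl y))).
have Pb : polytime body.
  apply: polytime_cons; first by apply: polytime_tl; apply: polytime_hd polytime_id.
  apply: polytime_cons; last by apply: polytime_tl; apply: polytime_tl polytime_id.
  apply: (@polytime_comp (fun _ y => tcons (thd (thd y)) (ttl y)) h _ Ph); apply: polytime_cons;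
      first by apply: polytime_hd; apply: polytime_hd polytime_id.
  exact: polytime_tl polytime_id.
pose loop (X : input) y := tcons tnil (tcons (tfold (h X) (thd y) (thd (ttl y)) (ttl (ttl y)))
  (ttl (ttl y))).
pose pre X t := tcons (l X t) (tcons (s X t) (e X t)).
suff Pw : polytime (fun X t => loop X (pre X t)).
  exact: polytime_hd (polytime_tl Pw).
have [cp [gp [Pgp Mp Hp Sp]]] : exists cp gp, [/\ polybounded gp, {homo gp : m n / m <= n},
    realizes cp pre gp & forall X t, tsz (pre X t) <= gp (tsz t)].
  by apply: polytime_elim; apply: polytime_cons Pl (polytime_cons Ps Pe).
have [c [g [Pg M H S]]] := polytime_elim Pb.
(* [B] bounds every accumulator: the potential [tsz s + tsz l * (n + n + 2) ^ k] never increases,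
   since each element consumed pays for the growth that it causes. As [tsz l] also bounds the number
   of rounds, [cost] multiplies by n. *)
pose B n := n + n * (n + n + 2) ^ k.
pose cost n := n * (g (n + B n + n + 2) + 10) + 10.
apply: (@polytime_intro (Seq cp (twhile c)) _ (fun n => gp n + (cost (gp n) + 2))).
  apply: (polybounded_add Pgp); apply: polybounded_add (polybounded_const 2).
  apply: (@polybounded_comp cost _ _ Pgp).
  apply: polybounded_add (polybounded_const _); apply: polybounded_mul polybounded_id _;
      apply: polybounded_add (polybounded_const _).
  apply: polybounded_comp Pg _.
  by rewrite /B; repeat first [exact: polybounded_const | exact: polybounded_id
                  | apply: polybounded_add | apply: polybounded_mul | apply: polybounded_exp].
move=> X t d o; apply: exec_Seq (Hp _ _ _ _) _.
have := Sp X t; set n := gp _.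
rewrite /pre; move: (l X t) (s X t) (e X t) => l0 s0 e0; rewrite !tsz_cons => le.
apply: exec_twhile.
have : tsz s0 + tsz l0 * (n + n + 2) ^ k <= B n.
  by rewrite /B leq_add ?leq_mul2r; lia.
have : tsz l0 <= n by lia.
have : tsz e0 <= n by lia.
suff W : forall l s, tsz e0 <= n -> tsz l <= n -> tsz s + tsz l * (n + n + 2) ^ k <= B n ->
   exec_loop X c (tcons l (tcons s e0)) d o
     (on_D (enc (tcons tnil (tcons (tfold (h X) l s e0) e0)) ++ d) o)
     (tsz l * (g (n + B n + n + 2) + 10) + 10).
  move=> He Hl Hs; apply: exec_while_leq (W _ _ He Hl Hs).
  by rewrite /cost leq_add2r leq_mul2r Hl orbT.
move=> {l0 s0 le} l0 s0 He; elim: l0 s0 => [|a _ l0 IH] s0 Hl Hs.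
  apply: exec_while_leq; last exact: (@exec_loop_stop _ _ (tcons tnil (tcons s0 e0))).
  exact: leq_addl.
move: Hl Hs; rewrite tsz_cons => Hl Hs.
have Hg := Hk X a s0 e0.
have {}Hg : tsz (h X (tcons a (tcons s0 e0))) <= tsz s0 + (n + n + 2) ^ k.
  by apply: leq_trans Hg _; rewrite leq_add2l; apply: leq_expn2r; lia.
apply: exec_while_leq; last first.
  apply: (exec_loop_step _ (H X (tcons (tcons a l0) (tcons s0 e0)) d o)) => //.
  apply: IH; first by lia.
  by move: Hg Hs => /=; move: (_ ^ k); nia.
have /M : tsz (tcons (tcons a l0) (tcons s0 e0)) <= n + B n + n + 2.
  by rewrite !tsz_cons; move: Hs; move: (_ ^ k); nia.
by move: (g _) (g _); nia.
Qed.

(* Syntactic matching keeps [apply] from unfolding the functions at hand. *)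
Ltac prove_polytime := lazymatch goal with
  | H : polytime ?f |- polytime ?f => exact H
  | |- polytime (fun X t => t) => exact polytime_id
  | |- polytime (fun X t => tcons (@?f X t) (@?h X t)) => refine (@polytime_cons f h _ _);
      prove_polytime
  | |- polytime (fun X t => thd (@?f X t)) => refine (@polytime_hd f _); prove_polytime
  | |- polytime (fun X t => ttl (@?f X t)) => refine (@polytime_tl f _); prove_polytime
  | |- polytime (fun X t => match _ with _ => _ end) => refine (polytime_if _ _ _); prove_polytime
  | |- polytime (fun X t => tbool (teqb (@?f X t) (@?h X t))) => refine (@polytime_eq f h _ _);
      prove_polytime
  | |- polytime (fun X t => query X (@?f X t)) => refine (@polytime_query f _); prove_polytime
  | |- _ => try first [assumption | exact (polytime_const _)]
  end.

(** * Configurations as trees *)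

Definition tlist (A : Type) (f : A -> tree) (l : seq A) : tree :=
  foldr (fun a t => tcons (f a) t) tnil l.

Lemma tlist_inj (A : Type) (f : A -> tree) : injective f -> injective (tlist f).
Proof. by move=> Hf; elim=> [|a l IH] [|b l'] //= [/Hf-> /IH->]. Qed.

Lemma tfold_tlist (A B : Type) (fA : A -> tree) (fB : B -> tree) (g : B -> A -> B) h e l s :
  (forall a s, h (tcons (fA a) (tcons (fB s) e)) = fB (g s a)) ->
  tfold h (tlist fA l) (fB s) e = fB (foldl g s l).
Proof. by move=> H; elim: l s => //= a l IH s; rewrite H IH. Qed.

Lemma tbool_inj : injective tbool. Proof. by move=> [] []. Qed.
Lemma tcell_inj : injective tcell. Proof. by move=> [[]|] [[]|]. Qed.
Lemma tanswer_inj : injective tanswer.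
Proof. by move=> [a b] [a' b'] [/tcell_inj-> /tbool_inj->]. Qed.

Definition trevapp (l r : tree) := tfold (fun y => tcons (thd y) (thd (ttl y))) l r tnil.

Lemma trevappE (A : Type) (f : A -> tree) l r :
  trevapp (tlist f l) (tlist f r) = tlist f (rev l ++ r).
Proof.
rewrite /trevapp (@tfold_tlist _ _ _ (tlist f) (fun s a => a :: s)) //.
by rewrite -catrevE; congr tlist; elim: l r => //= a l IH r; rewrite IH.
Qed.

Lemma polytime_revapp l r : polytime l -> polytime r ->
    polytime (fun X t => trevapp (l X t) (r X t)).
Proof.
move=> Pl Pr; apply: (@polytime_fold (fun _ y => tcons (thd y) (thd (ttl y)))); prove_polytime.
exists 2 => _ a s e; rewrite /= tsz_cons; have := tsz_gt0 e.
by rewrite expnS expn1; nia.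
Qed.

(** A chain of comparisons with finitely many fixed codes. It brings finite tables, such as a
    transition function, into polynomial time. *)
Fixpoint tcase (K : Type) (code : K -> tree) (h : K -> tree -> tree) (ks : seq K) key t :=
  if ks is k :: ks' then
    if tbool (teqb key (code k)) is tnil then tcase code h ks' key t else h k t
  else tnil.

Lemma tcaseE (K : eqType) (code : K -> tree) h ks k t :
  injective code -> k \in ks -> tcase code h ks (code k) t = h k t.
Proof.
move=> inj; elim: ks => //= k' ks IH; rewrite inE.
case: teqbP => [/inj-> //|N] /orP[/eqP E|/IH //].
by case: N; rewrite E.
Qed.

Lemma polytime_case (K : Type) (code : K -> tree) h ks key :
  (forall k, polytime (fun _ t => h k t)) -> polytime key ->
  polytime (fun X t => tcase code h ks (key X t) t).
Proof. by move=> Hh Hk; elim: ks => /= [|k ks IH]; prove_polytime. Qed.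

(** The left part is stored nearest cell first, so that a move touches only the front cells of the
    two lists. With an empty left part [MLeft] stays put, as the head position 0 does. *)
Definition zipper := (seq (option bool) * seq (option bool))%type.
Definition tape_of (z : zipper) := Tape (rev z.1 ++ z.2) (size z.1).
Definition zact (z : zipper) s m : zipper :=
  let: (l, r) := (z.1, s :: behead z.2) in
  match m with
  | MStay => (l, r)
  | MRight => (s :: l, behead z.2)
  | MLeft => if l is c :: l' then (l', c :: r) else (l, r)
  end.

Lemma tape_of_read z : tape_read (tape_of z) = head None z.2.
Proof. by rewrite /tape_read /= nth_cat size_rev ltnn subnn; case: z.2. Qed.

Lemma tape_of_act z s m : tape_of (zact z s m) = tape_move (tape_write (tape_of z) s) m.
Proof.
case: z => l r.
have E : set_nth None (rev l ++ r) (size l) s = rev l ++ s :: behead r.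
  rewrite -(size_rev l); elim: (rev l) => [|c k IH] /=; first by case: r => //= ? [].
  by rewrite IH.
rewrite /tape_of /tape_write /tape_move /= E; case: m => //=.
- by case: l {E} => [|c l] //=; rewrite rev_cons cat_rcons.
- by rewrite rev_cons cat_rcons.
Qed.

Definition tzip (z : zipper) := tcons (tlist tcell z.1) (tlist tcell z.2).

Definition tact s m (z : tree) :=
  let r := tcons (tcell s) (ttl (ttl z)) in
  match m with
  | MStay => tcons (thd z) r
  | MRight => tcons (tcons (tcell s) (thd z)) (ttl (ttl z))
  | MLeft => if thd z is tnil then tcons (thd z) r
             else tcons (ttl (thd z)) (tcons (thd (thd z)) r)
  end.

Lemma tact_tzip s m z : tact s m (tzip z) = tzip (zact z s m).
Proof. by case: z m => l r [] /=; case: l => //=; case: r. Qed.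

Lemma polytime_tact s m z : polytime z -> polytime (fun X t => tact s m (z X t)).
Proof. by move=> Pz; case: m; rewrite /tact; prove_polytime. Qed.

Section Machine.
Variable M : TM.
Local Notation Q := (tm_state M).

(** A vertex of the configuration graph: a running configuration without choice tape and output. The
    bits read and written become labels of edges. *)
Definition node := (Q * (zipper * zipper))%type.

Inductive outcome :=
| OHalt (b : bool)
| OChoose (z0 z1 : node)
| OStep (z : node) (o : option bool).

Definition node_view (X : input) (z : node) : view :=
  let: (a, p) := query_at X (tape_value (tape_of z.2.2)) in
  View a p (head None z.2.1.2) (head None z.2.2.2).

Definition kids (X : input) (z : node) : outcome :=
  match tm_delta z.1 (node_view X z) with
  | AHalt b => OHalt b
  | AChoose q0 q1 => OChoose (q0, z.2) (q1, z.2)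
  | AStep q ww wm iw im o => OStep (q, (zact z.2.1 ww wm, zact z.2.2 iw im)) o
  end.

Definition config_of (z : node) c o : config Q :=
  Config (Running z.1) (tape_of z.2.1) (tape_of z.2.2) c o.

Lemma step_kids x k z c o :
  @step M x k (config_of z c o) =
  match kids (x, k) z with
  | OHalt b => Config (Halted b) (tape_of z.2.1) (tape_of z.2.2) c o
  | OChoose z0 z1 => if c is b :: c' then config_of (if b then z1 else z0) c' o
                     else Config Dead (tape_of z.2.1) (tape_of z.2.2) [::] o
  | OStep z' e => config_of z' c (if e is Some b then rcons o b else o)
  end.
Proof.
case: z => q [w i]; rewrite /step /kids /node_view /= !tape_of_read.
case: tm_delta => [b|q0 q1|q' ww wm iw im e] //.
- by case: c => // -[].
- by rewrite /config_of /= !tape_of_act; case: e.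
Qed.

Definition node0 : node := (tm_start M, (([::], [::]), ([::], [::]))).

Lemma init_node0 c : init M c = config_of node0 c [::]. Proof. by []. Qed.

Definition tstate (q : Q) := tlist (fun=> tnil) (nseq (enum_rank q) tt).

Lemma tstate_inj : injective tstate.
Proof.
move=> q q' /(@tlist_inj _ (fun=> tnil)) E; apply: enum_rank_inj; apply: val_inj.
have /(congr1 size) := E (fun x y => let: tt := x in let: tt := y in fun=> erefl).
by rewrite !size_nseq.
Qed.

Definition tnode (z : node) := tcons (tstate z.1) (tcons (tzip z.2.1) (tzip z.2.2)).

Lemma tnode_inj : injective tnode.
Proof.
have zi : injective tzip.
  by move=> [l r] [l' r'] [/(tlist_inj tcell_inj)-> /(tlist_inj tcell_inj)->].
move=> [q [w i]] [q' [w' i']] E.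
have /tstate_inj -> : tstate q = tstate q' := congr1 thd E.
have /zi -> : tzip w = tzip w' := congr1 (thd \o ttl) E.
by have /zi -> : tzip i = tzip i' := congr1 (ttl \o ttl) E.
Qed.

(** The three tags are told apart by two emptiness tests, first on [thd r] and then on
    [ttl (thd r)]. *)
Definition toutcome r :=
  match r with
  | OHalt b => tcons tnil (tbool b)
  | OChoose z0 z1 => tcons (tbool true) (tcons (tnode z0) (tnode z1))
  | OStep z o => tcons (tcons tnil (tbool true)) (tcons (tnode z) (tcell o))
  end.

(** All that a transition depends on. The type is finite, and once its element is known the
    successor is a fixed rearrangement of the tree of the configuration. *)
Definition situation := (Q * (option bool * (option bool * (option bool * bool))))%type.

Definition tsituation (v : situation) :=
  tcons (tstate v.1) (tcons (tcell v.2.1) (tcons (tcell v.2.2.1) (tanswer v.2.2.2))).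

Lemma tsituation_inj : injective tsituation.
Proof.
move=> [q [a [b r]]] [q' [a' [b' r']]] E.
have /tstate_inj -> : tstate q = tstate q' := congr1 thd E.
have /tcell_inj -> : tcell a = tcell a' := congr1 (thd \o ttl) E.
have /tcell_inj -> : tcell b = tcell b' := congr1 (thd \o (ttl \o ttl)) E.
by have /tanswer_inj -> : tanswer r = tanswer r' := congr1 (ttl \o (ttl \o ttl)) E.
Qed.

Definition tkids_in (v : situation) (t : tree) : tree :=
  match tm_delta v.1 (View v.2.2.2.1 v.2.2.2.2 v.2.1 v.2.2.1) with
  | AHalt b => tcons tnil (tbool b)
  | AChoose q0 q1 =>
      tcons (tbool true) (tcons (tcons (tstate q0) (ttl t)) (tcons (tstate q1) (ttl t)))
  | AStep q ww wm iw im o =>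
      tcons (tcons tnil (tbool true))
        (tcons (tcons (tstate q) (tcons (tact ww wm (thd (ttl t))) (tact iw im (ttl (ttl t)))))
           (tcell o))
  end.

Definition tkids (X : input) (t : tree) : tree :=
  tcase tsituation tkids_in (enum {: situation})
    (tcons (thd t) (tcons (thd (ttl (thd (ttl t)))) (tcons (thd (ttl (ttl (ttl t))))
       (query X (trevapp (thd (ttl (ttl t))) (ttl (ttl (ttl t)))))))) t.

Lemma tape_value_tcells l h h' :
  tape_value (Tape (tcells (tlist tcell l)) h) = tape_value (Tape l h').
Proof.
by rewrite /tape_value /=; elim: l => //= c l ->; case: c => [[]|].
Qed.

Lemma tkidsE X z : tkids X (tnode z) = toutcome (kids X z).
Proof.
(* An exhausted right part reads as a blank, because [thd tnil] and [tcell None] are both [tnil]. *)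
have th l : thd (tlist tcell l) = tcell (head None l) by case: l.
pose v : situation := (z.1, (head None z.2.1.2, (head None z.2.2.2,
  query_at X (tape_value (tape_of z.2.2))))).
rewrite /tkids [X in tcase _ _ _ X _](_ : _ = tsituation v); last first.
  rewrite /tsituation /= !th trevappE /query (@tape_value_tcells _ _ (size z.2.2.1)).
  by [].
rewrite tcaseE ?mem_enum //; last exact: tsituation_inj.
rewrite /tkids_in /kids /node_view /v /=.
case: tm_delta => // q' ww wm iw im o.
exact: (f_equal2 (fun w i => tcons (tcons tnil (tbool true))
  (tcons (tcons (tstate q') (tcons w i)) (tcell o)))
  (tact_tzip ww wm z.2.1) (tact_tzip iw im z.2.2)).
Qed.

Lemma polytime_tkids t : polytime t -> polytime (fun X y => tkids X (t X y)).
Proof.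
move=> Pt; apply: (@polytime_comp t tkids Pt) => {t Pt}.
apply: polytime_case => [v|].
- rewrite /tkids_in; case: tm_delta => [b|q0 q1|q' ww wm iw im o]; prove_polytime.
  + by apply: polytime_tact; prove_polytime.
  + by apply: polytime_tact; prove_polytime.
- by prove_polytime; apply: polytime_revapp; prove_polytime.
Qed.

End Machine.

(** * Computability of exponential bounds *)

(** The mark in cell 0 turns the blank tape into the representation of five empty stacks. *)
Definition program c := tm_of (Seq (put (Some true)) c).

Lemma exec_program c x k s n : exec (x, k) c (on_D [::] [::]) s n ->
  exists t, [/\ t <= 40 * n * (n + 1) + 2, halted (conf_at (program c) x k [::] t) &
    cf_output (conf_at (program c) x k [::] t) = s_out s].
Proof.
move=> [_ T].
have H0 : exec_raw (x, k) (put (Some true)) (AState (fun=> None) 0 empty_tape [::])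
    (abs (on_D [::] [::]) 0) 1.
  apply: raw_put => p; case: eqP => [->//|N].
  rewrite /wcell; have Hp : p %% width < 6 by apply: ltn_pmod.
  have := divn_eq p width; move: Hp; case: (p %% width) => [|[|[|[|[|[|//]]]]]] _ /=;
    rewrite ?nth_nil //.
  by case: (p %/ width) => [|[]].
have [|m [t [R [_ _ _ E] L]]] := raw_Seq H0 T (m := blank_mstate).
  by split=> //= p; rewrite nth_nil.
exists t.+1; have [Hh Ho] := run_tm_of R; split=> //; last by rewrite Ho E.
by move: L; rewrite /hgt /=; lia.
Qed.

Lemma iter_halted M x k n b w i c o :
  iter n (@step M x k) (Config (Halted b) w i c o) = Config (Halted b) w i c o.
Proof. by elim: n => //= n ->. Qed.

Lemma iter_dead M x k n w i c o :
  iter n (@step M x k) (Config Dead w i c o) = Config Dead w i c o.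
Proof. by elim: n => //= n ->. Qed.

Definition tunary n := tlist (fun=> tnil) (nseq n tt).

Definition tdouble (b acc : tree) :=
  tfold (fun y => tcons tnil (tcons tnil (thd (ttl y)))) acc b tnil.

Lemma tdoubleE (b : bool) n : tdouble (tbool b) (tunary n) = tunary (n.*2 + b).
Proof.
have -> : tbool b = tunary b by case: b.
rewrite /tdouble /tunary (@tfold_tlist _ _ _ tunary (fun m _ => m.+2)) //.
congr tunary; elim: n (nat_of_bool b) => //= n IH m.
by rewrite IH !addnS doubleS !addSn.
Qed.

Lemma polytime_double b acc : polytime b -> polytime acc ->
    polytime (fun X t => tdouble (b X t) (acc X t)).
Proof.
move=> Pb Pa; apply: (@polytime_fold (fun _ y => tcons tnil (tcons tnil (thd (ttl y)))));
    prove_polytime.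
by exists 2 => _ a s e; rewrite /= !tsz_cons /tsz /= expnS expn1; nia.
Qed.

Lemma out_val_rcons s b : out_val (rcons s b) = (out_val s).*2 + b.
Proof. by rewrite /out_val foldl_rcons. Qed.

(** Explains the shape of the computable bounds: a number of the form 2^m - 1 can be printed from m
    in unary. *)
Lemma out_val_nseq m : out_val (nseq m true) = 2 ^ m - 1.
Proof.
elim: m => // m IH; rewrite -addn1 nseqD cats1 out_val_rcons IH addn1 expnS.
have := expn_gt0 2 m; lia.
Qed.

Section Exponential.
Variables (M : TM) (a b : nat).

(** The output tape is write-only, so the value of a computed function becomes data only by
    simulating its machine and collecting the output in a list, last bit first. *)
Definition tsim (X : input) (y : tree) :=
  let r := tkids M X (thd (ttl y)) in
  if thd r is tnil then tcons tnil (ttl y)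
  else tcons (tbool true) (tcons (thd (ttl r))
    (if ttl (ttl r) is tnil then ttl (ttl y) else tcons (thd (ttl (ttl r))) (ttl (ttl y)))).

Lemma polytime_sim : polytime tsim.
Proof. by rewrite /tsim; prove_polytime; apply: polytime_tkids; prove_polytime. Qed.

Lemma exec_loop_sim k c g z o n cf d : realizes c tsim g ->
  cf = iter n (@step M [::] k) (config_of z [::] o) -> halted cf ->
  exists t m, exec_loop ([::], k) c (tcons (tbool true) (tcons (tnode z) (tlist tbool (rev o))))
      d [::]
     (on_D (enc (tcons tnil (tcons t (tlist tbool (rev (cf_output cf))))) ++ d) [::]) m.
Proof.
move=> H ->; elim: n z o => [//|n IH] z o; rewrite iterSr step_kids.
case E: (kids ([::], k) z) => [v|z0 z1|z' e].
- rewrite iter_halted => _; exists (tnode z); eexists.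
  apply: (@exec_loop_step _ _ _ (tcons tnil (tcons (tnode z) (tlist tbool (rev o))))) => //.
    have := H ([::], k) (tcons (tbool true) (tcons (tnode z) (tlist tbool (rev o)))) d [::].
    by rewrite /tsim [thd (ttl _)]/= tkidsE E; apply.
  exact: exec_loop_stop.
(* A choice step on the empty choice tape is dead, contrary to halting. *)
- by rewrite iter_dead.
- case/IH => t [m W]; exists t; eexists.
  apply: exec_loop_step W => //.
  have := H ([::], k) (tcons (tbool true) (tcons (tnode z) (tlist tbool (rev o)))) d [::].
  rewrite /tsim [thd (ttl _)]/= tkidsE E.
  by case: e {E} => [e|] /=; rewrite ?rev_rcons; apply.
Qed.

Definition tdigit (_ : input) (y : tree) := tcons (ttl (thd y)) (tdouble (thd (thd y)) (ttl y)).

Lemma polytime_digit : polytime tdigit.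
Proof. by rewrite /tdigit; prove_polytime; apply: polytime_double; prove_polytime. Qed.

(** The unary accumulator doubles with every digit, which [slow_growth] rules out; hence a bare loop
    in place of a fold, with an existential running time, since [computable] asks only for
    termination. *)
Lemma exec_loop_digit X c g l m d : realizes c tdigit g ->
  exists n, exec_loop X c (tcons (tlist tbool l) (tunary m)) d [::]
    (on_D (enc (tcons tnil (tunary (foldl (fun a (b : bool) => a.*2 + b) m l))) ++ d) [::]) n.
Proof.
move=> H; elim: l m => [|v l IH] m; first by eexists; apply: exec_loop_stop.
have [n W] := IH (m.*2 + v); eexists; apply: exec_loop_step W => //.
have := H X (tcons (tlist tbool (v :: l)) (tunary m)) d [::].
by rewrite /tdigit [thd (thd _)]/= [ttl (tcons _ _)]/= tdoubleE; apply.
Qed.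

Definition emits n := iter n (Seq (emit true)) skip.

Lemma exec_emits X n s d : exec X (emits n) (on_D d s) (on_D d (s ++ nseq n true)) (n + 1).
Proof.
elim: n s => [|n IH] s; first by rewrite cats0; exact: exec_skip.
apply: (@exec_Seq _ _ _ _ _ _ 1 (n + 1)); first exact: exec_emit.
by have := IH (rcons s true); rewrite cat_rcons.
Qed.

Lemma exec_loop_unary X c g n d o : realizes c (fun _ y => tcons (ttl (thd y)) tnil) g ->
  exists m, exec_loop X (Seq c (emits a)) (tcons (tunary n) tnil) d o
    (on_D (enc (tcons tnil tnil) ++ d) (o ++ nseq (a * n) true)) m.
Proof.
move=> H; elim: n o => [|n IH] o; first by rewrite muln0 cats0; eexists; apply: exec_loop_stop.
have [m W] := IH (o ++ nseq a true); eexists.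
rewrite mulnS nseqD catA; apply: exec_loop_step W => //.
by apply: exec_Seq (exec_emits _ _ _ _); exact: H.
Qed.

End Exponential.

(* Simulate the machine for [f], turn its output into unary by Horner's rule, print ones. *)
Lemma computable_exp f a b : computable f -> computable (fun k => 2 ^ (a * f k + b) - 1).
Proof.
move=> [M HM].
have [c1 [g1 [_ _ R1 _]]] := polytime_elim (polytime_sim M).
have P2 : polytime (fun _ y => tcons (trevapp (ttl (ttl y)) tnil) tnil).
  by prove_polytime; apply: polytime_revapp; prove_polytime.
have [c2 [g2 [_ _ R2 _]]] := polytime_elim P2.
have [c3 [g3 [_ _ R3 _]]] := polytime_elim polytime_digit.
have [c4 [g4 [_ _ R4 _]]] := polytime_elim (polytime_cons (polytime_tl polytime_id) polytime_nil).
have [c5 [g5 [_ _ R5 _]]] := polytime_elim (polytime_cons (polytime_tl (polytime_hd polytime_id))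
    polytime_nil).
pose main := Seq (pushes (enc (tcons (tbool true) (tcons (tnode (node0 M)) tnil))))
  (Seq (twhile c1) (Seq c2 (Seq (twhile c3) (Seq c4 (Seq (twhile (Seq c5 (emits a))) (emits
      b)))))).
exists (program main) => k; have [n [Hh Ho]] := HM k.
suff [s [m [T Es]]] : exists s m, exec ([::], k) main (on_D [::] [::]) s m /\
    s_out s = nseq (a * f k + b) true.
  by have [t [_ Ht E]] := exec_program T; exists t; split=> //; rewrite E Es out_val_nseq.
have [t [m1 W1]] := exec_loop_sim (z := node0 M) (o := [::]) [::] R1 (erefl _) Hh.
have [m3 W3] := exec_loop_digit ([::], k) (cf_output (conf_at M [::] k [::] n)) 0 [::] R3.
have [m5 W5] := @exec_loop_unary a ([::], k) _ _ (f k) [::] [::] R5.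
have E2 l : trevapp (tlist tbool (rev l)) tnil = tlist tbool l.
  by rewrite (trevappE tbool _ [::]) revK cats0.
eexists; eexists; split.
  apply: exec_Seq; first exact: exec_pushes.
  apply: exec_Seq; first exact: exec_twhile W1.
  apply: exec_Seq; first exact: R2.
  cbv beta; rewrite [ttl (ttl _)]/= E2.
  apply: exec_Seq; first exact: exec_twhile W3.
  apply: exec_Seq; first exact: R4.
  rewrite -[foldl _ _ _]/(out_val _) Ho /=.
  apply: exec_Seq; first exact: exec_twhile W5.
  exact: exec_emits.
by rewrite /= nseqD.
Qed.

(** * Counting accepting paths *)

Section Paths.
Variables (M : TM) (x : seq bool) (k : nat).
Local Notation node := (node M).
Local Notation kids := (@kids M (x, k)).

(** The choice sequences read exactly by an accepting run from z within t steps. The halting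
    transition counts as a step, so [acc 0] is empty. *)
Fixpoint acc t (z : node) : seq (seq bool) :=
  if t is t'.+1 then
    match kids z with
    | OHalt b => if b then [:: [::]] else [::]
    | OChoose z0 z1 => map (cons false) (acc t' z0) ++ map (cons true) (acc t' z1)
    | OStep z' _ => acc t' z'
    end
  else [::].

Definition num t z := size (acc t z).

Lemma cons_inj (T : Type) (a : T) : injective (cons a). Proof. by move=> s s' []. Qed.

Lemma mem_map_cons (b b' : bool) c s : (b' :: c \in map (cons b) s) = (b == b') && (c \in s).
Proof.
case: (altP eqP) => [<-|N]; first by rewrite (mem_map (@cons_inj _ b)).
by apply/mapP => -[c' _ [E _]]; rewrite E eqxx in N.
Qed.

Definition accepts (cf : config (tm_state M)) :=
  (if cf_status cf is Halted true then true else false) && (cf_choices cf == [::]).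

Lemma mem_acc t z c o : (c \in acc t z) = accepts (iter t (@step M x k) (config_of z c o)).
Proof.
elim: t z c o => // t IH z c o; rewrite iterSr step_kids /=.
case: (kids z) => [b|z0 z1|z' e].
- by rewrite iter_halted /accepts; case: b; rewrite ?inE.
- rewrite mem_cat; case: c => [|b c].
    rewrite iter_dead /accepts /=; apply/negbTE/norP; split; by apply/mapP => -[].
  by rewrite -IH !mem_map_cons; case: b; rewrite //= orbF.
- exact: IH.
Qed.

Lemma accepting_pathP c : accepting_path M x k c <-> exists t, c \in acc t (node0 M).
Proof.
split=> [[t [H1 H2]]|[t]]; last rewrite (mem_acc _ _ _ [::]).
- by exists t; rewrite (mem_acc _ _ _ [::]) /accepts -[config_of _ _ _]/(init M c)
    -/(conf_at M x k c t) H1 H2.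
- move=> /andP[H /eqP E]; exists t; split=> //.
  by move: H; rewrite /conf_at init_node0; case: cf_status => // -[].
Qed.

Lemma uniq_acc t z : uniq (acc t z).
Proof.
elim: t z => // t IH z /=; case: (kids z) => [[]|z0 z1|z' _] //.
rewrite cat_uniq !map_inj_uniq ?IH; try exact: cons_inj; rewrite andbT /=.
by apply/hasPn => _ /mapP[c _ ->]; apply/mapP => -[].
Qed.

Definition expand (g : node -> nat) (z : node) : nat :=
  match kids z with
  | OHalt b => b
  | OChoose z0 z1 => g z0 + g z1
  | OStep z' _ => g z'
  end.

Lemma numS t z : num t.+1 z = expand (num t) z.
Proof.
by rewrite /num /expand /=; case: (kids z) => [[]|z0 z1|] //; rewrite size_cat !size_map.
Qed.

Definition kidlist (z : node) : seq node :=
  match kids z with OHalt _ => [::] | OChoose z0 z1 => [:: z0; z1] | OStep z' _ => [:: z'] end.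

Lemma leq_expand g g' z : (forall z', z' \in kidlist z -> g z' <= g' z') ->
  expand g z <= expand g' z.
Proof.
rewrite /kidlist /expand; case: (kids z) => // [z0 z1|z' _] H.
- by rewrite leq_add ?H ?inE ?eqxx ?orbT.
- by rewrite H ?inE.
Qed.

(** Each step at most doubles the number. This keeps the binary numbers of the table short. *)
Lemma num_leq_exp t z : num t z <= 2 ^ t.
Proof.
elim: t z => [|t IH] z; first by [].
rewrite numS; apply: leq_trans (leq_expand (g' := fun=> 2 ^ t) _) _ => //.
rewrite /expand expnS; case: (kids z) => [b|_ _|_ _]; last by rewrite leq_pmull.
- by case: b; rewrite ?muln_gt0 ?expn_gt0.
- by rewrite mul2n addnn.
Qed.

(** The run carries its list of configurations, so that repetitions on it can be excluded and its
    length bounded by counting. *)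
Inductive accepting_trace : node -> seq bool -> seq node -> Prop :=
| accepting_trace_halt z : kids z = OHalt M true -> accepting_trace z [::] [:: z]
| accepting_trace_choose z z0 z1 b c p : kids z = OChoose z0 z1 ->
    accepting_trace (if b then z1 else z0) c p -> accepting_trace z (b :: c) (z :: p)
| accepting_trace_step z z' e c p : kids z = OStep z' e -> accepting_trace z' c p ->
    accepting_trace z c (z :: p).

Lemma acc_accp t z c : c \in acc t z -> exists p, accepting_trace z c p.
Proof.
elim: t z c => // t IH z c /=.
case E: (kids z) => [[]|z0 z1|z' e] //.
- by rewrite inE => /eqP->; exists [:: z]; apply: accepting_trace_halt.
- rewrite mem_cat; case/orP=> /mapP[c' /IH[p Hp] ->]; exists (z :: p).
  + exact: (@accepting_trace_choose _ _ _ false _ _ E Hp).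
  + exact: (@accepting_trace_choose _ _ _ true _ _ E Hp).
- by move=> /IH[p Hp]; exists (z :: p); apply: accepting_trace_step E Hp.
Qed.

Lemma accepting_trace_acc z c p t : accepting_trace z c p -> size p <= t -> c \in acc t z.
Proof.
move=> H; elim: H t => {z c p} [z E|z z0 z1 b c p E _ IH|z z' e c p E _ IH] [|t] //= L;
  rewrite E ?inE //; last exact: IH.
by rewrite mem_cat !mem_map_cons; have := IH t L; clear; case: b => /= ->; rewrite ?orbT.
Qed.

Lemma accepting_trace_inv z c p : accepting_trace z c p ->
  match kids z with
  | OHalt _ => p = [:: z]
  | OChoose z0 z1 => exists b c' p',
      [/\ c = b :: c', p = z :: p' & accepting_trace (if b then z1 else z0) c' p']
  | OStep z' _ => exists2 p', p = z :: p' & accepting_trace z' c p'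
  end.
Proof.
case=> {z c p} [z ->|z z0 z1 b c p -> H|z z' e c p -> H] //; last by exists p.
by exists b, c, p.
Qed.

Lemma accepting_trace_fun z c p p' : accepting_trace z c p -> accepting_trace z c p' -> p = p'.
Proof.
move=> H; elim: H p' => {z c p} [z E|z z0 z1 b c p E _ IH|z z' e c p E _ IH] p'
    /accepting_trace_inv;
  rewrite E //.
- by case=> b' [c' [q [[<- <-] -> /IH->]]].
- by case=> q -> /IH->.
Qed.

Inductive word_path : node -> seq bool -> node -> Prop :=
| word_path_refl z : word_path z [::] z
| word_path_choose z z0 z1 b w z' : kids z = OChoose z0 z1 ->
    word_path (if b then z1 else z0) w z' -> word_path z (b :: w) z'
| word_path_step z z1 e w z' : kids z = OStep z1 e -> word_path z1 w z' -> word_path z w z'.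

Lemma word_path_trans z z' z'' w w' : word_path z w z' -> word_path z' w' z'' ->
    word_path z (w ++ w') z''.
Proof.
move=> H H'; elim: H H' => {z w z'} [z //|z z0 z1 b w z' E _ IH|z z1 e w z' E _ IH] /IH H.
- exact: word_path_choose E H.
- exact: word_path_step E H.
Qed.

Lemma word_path_iter z w z' c o : word_path z w z' ->
  exists n o', iter n (@step M x k) (config_of z (w ++ c) o) = config_of z' c o'.
Proof.
move=> H; elim: H o => {z w z'} [z|z z0 z1 b w z' E _ IH|z z1 e w z' E _ IH] o.
- by exists 0, o.
- have [n [o' E']] := IH o; exists n.+1, o'.
  by rewrite iterSr step_kids E.
- have [n [o' E']] := IH (if e is Some b then rcons o b else o); exists n.+1, o'.
  by rewrite iterSr step_kids E.
Qed.

Definition reach z := exists w, word_path (node0 M) w z.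

Lemma reach0 : reach (node0 M). Proof. by exists [::]; apply: word_path_refl. Qed.

Lemma reach_pw z w z' : reach z -> word_path z w z' -> reach z'.
Proof. by move=> [w0 H0] H; exists (w0 ++ w); apply: word_path_trans H0 H. Qed.

(** With exactly the word read on the way as choice tape, the resource bounds on actual runs apply
    to every reachable configuration. *)
Lemma reach_conf z : reach z -> exists c n o, conf_at M x k c n = config_of z [::] o.
Proof.
move=> [w H]; have [n [o E]] := word_path_iter [::] [::] H.
by exists w, n, o; rewrite /conf_at init_node0 -E cats0.
Qed.

Lemma reach_kid z z' : reach z -> z' \in kidlist z -> reach z'.
Proof.
move=> R; rewrite /kidlist; case E: (kids z) => [//|z0 z1|z1 e].
- rewrite !inE => /orP[] /eqP->; apply: (reach_pw R).
  + by apply: (@word_path_choose _ _ _ false) E _; apply: word_path_refl.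
  + by apply: (@word_path_choose _ _ _ true) E _; apply: word_path_refl.
- by rewrite inE => /eqP->; apply: (reach_pw R); apply: word_path_step E _; apply: word_path_refl.
Qed.

Lemma accepting_trace_mem z c p z' : accepting_trace z c p -> z' \in p ->
  exists w c' p', [/\ c = w ++ c', word_path z w z',
      accepting_trace z' c' p' & size p' <= size p].
Proof.
move=> H; elim: H => {z c p} [z E|z z0 z1 b c p E H IH|z z1 e c p E H IH];
  rewrite in_cons => /orP[/eqP->|].
- by exists [::], [::], [:: z]; split=> //; [apply: word_path_refl | apply: accepting_trace_halt].
- by [].
- exists [::], (b :: c), (z :: p); split=> //; [exact: word_path_refl | exact:
    accepting_trace_choose E H].
- move=> /IH[w [c' [p' [-> Hw Ha L]]]]; exists (b :: w), c', p'; split=> //.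
  + exact: word_path_choose E Hw.
  + exact: leqW.
- exists [::], c, (z :: p); split=> //; [exact: word_path_refl | exact: accepting_trace_step E H].
- move=> /IH[w [c' [p' [-> Hw Ha L]]]]; exists w, c', p'; split=> //.
  + exact: word_path_step E Hw.
  + exact: leqW.
Qed.

Section Bounded.
Variable B : nat.
Hypothesis bounded : forall c n, size c - size (cf_choices (conf_at M x k c n)) <= B.

(* Pumping a cycle that reads a bit would read arbitrarily many bits. *)
Lemma cycle_reads_nothing z w : reach z -> word_path z w z -> w = [::].
Proof.
move=> [w0 H0] Hw; apply/eqP; rewrite -size_eq0 -leqn0 leqNgt; apply/negP => L.
have Hm m : word_path z (flatten (nseq m w)) z.
  by elim: m => [|m IH] /=; [exact: word_path_refl | exact: word_path_trans Hw IH].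
have [n [o E]] := word_path_iter [::] [::] (word_path_trans H0 (Hm B.+1)).
have := bounded (w0 ++ flatten (nseq B.+1 w)) n.
rewrite /conf_at init_node0; rewrite cats0 in E; rewrite E subn0 size_cat.
suff : B.+1 <= size (flatten (nseq B.+1 w)) by move: (size (flatten _)) => q; lia.
by elim: B.+1 => //= m IH; rewrite size_cat -add1n leq_add.
Qed.

(** If z recurs, the cycle reads nothing. This is absurd after a choice; after an ordinary step the
    second visit faces the same remaining word, hence the same trace, although its trace is strictly
    shorter. *)
Lemma accepting_trace_uniq z c p : reach z -> accepting_trace z c p -> uniq p.
Proof.
move=> R H; elim: H R => {z c p} [z E|z z0 z1 b c p E H IH|z z1 e c p E H IH] R //=.
- have H1 : word_path z [:: b] (if b then z1 else z0) by apply: word_path_choose E _;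
    apply: word_path_refl.
  rewrite IH ?andbT; last exact: reach_pw R H1.
  apply/negP => /(accepting_trace_mem H)[w [c' [p' [_ Hw _ _]]]].
  by have := cycle_reads_nothing R (word_path_trans H1 Hw).
- have H1 : word_path z [::] z1 by apply: word_path_step E _; apply: word_path_refl.
  rewrite IH ?andbT; last exact: reach_pw R H1.
  apply/negP => /(accepting_trace_mem H)[w [c' [p' [Ec Hw Ha L]]]].
  have E0 := cycle_reads_nothing R (word_path_trans H1 Hw); rewrite /= in E0.
  have := accepting_trace_fun (accepting_trace_step E H) (p' := p').
  by rewrite Ec E0 => /(_ Ha) E1; move: L; rewrite -E1 /= ltnn.
Qed.

Variable S : nat.
Hypothesis reach_card : forall s : seq node, uniq s -> (forall z, z \in s -> reach z) ->
    size s <= S.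

(** The trace repeats no configuration, so it visits at most S of them and S steps already exhibit
    it. *)
Lemma acc_stable t z : reach z -> {subset acc t z <= acc S z}.
Proof.
move=> R c /acc_accp[p Hp]; apply: (accepting_trace_acc Hp); apply: reach_card.
- exact: accepting_trace_uniq R Hp.
- by move=> z' /(accepting_trace_mem Hp)[w [c' [p' [_ Hw _ _]]]]; apply: reach_pw R Hw.
Qed.

Lemma num_stable t z : reach z -> num t z <= num S z.
Proof. by move=> R; apply: uniq_leq_size (uniq_acc _ _) (acc_stable R). Qed.

Lemma num_acc_num F : num_acc M x k F -> num S (node0 M) = F.
Proof.
move=> [s [us Hs <-]]; apply: perm_size; apply: uniq_perm => //; first exact: uniq_acc.
move=> c; apply/idP/idP => [H|/Hs/accepting_pathP[t]].
- by apply/Hs/accepting_pathP; exists S.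
- exact/acc_stable/reach0.
Qed.

End Bounded.

Lemma num_mono t t' z : t <= t' -> num t z <= num t' z.
Proof.
elim: t t' z => [|t IH] [|t'] z //= L; rewrite !numS.
by apply: leq_expand => z' _; apply: IH.
Qed.

(** * Counting reachable configurations by the space bound *)

Definition zsize (z : zipper) := size z.1 + size z.2.

Lemma zsize_act z s m : zsize (zact z s m) <= maxn (zsize z) (size z.1).+1.
Proof. by case: z => [[|c l] [|d r]]; case: m; rewrite /zsize /zact /=; lia. Qed.

Section Space.
Variable H : nat.
Hypothesis heads : forall c n,
  t_head (cf_work (conf_at M x k c n)) <= H /\ t_head (cf_index (conf_at M x k c n)) <= H.

(** A zipper grows only when the cell just beyond its end is written; the head then stands there, at
    a position of at most H. *)
Lemma reach_zsize z : reach z -> zsize z.2.1 <= H.+1 /\ zsize z.2.2 <= H.+1.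
Proof.
move=> [w]; move: (node0 M) reach0 (conj (leq0n H.+1) (leq0n H.+1) :
  zsize (node0 M).2.1 <= H.+1 /\ zsize (node0 M).2.2 <= H.+1) => z0 + + P.
elim: P => {z0 w z} [//|z z0 z1 b w z' E _ IH|z z1 e w z' E _ IH] R Hz; apply: IH.
- apply: (reach_kid R); rewrite /kidlist E !inE; by case: b; rewrite eqxx ?orbT.
- move: E; rewrite /kids; case: tm_delta => // q0 q1 [<- <-].
  by case: b.
- by apply: (reach_kid R); rewrite /kidlist E !inE.
- have [c [n [o Ec]]] := reach_conf R.
  have [Hw Hi] := heads c n; rewrite Ec /= in Hw Hi.
  move: E; rewrite /kids; case: tm_delta => // q ww wm iw im o' [<- _] /=.
  by have := zsize_act z.2.1 ww wm; have := zsize_act z.2.2 iw im; lia.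
Qed.

Definition enc_cells L (s : seq (option bool)) : {ffun 'I_L -> option (option bool)} :=
  [ffun i : 'I_L => nth None (map Some s) i].

Lemma enc_cells_inj L s s' : size s <= L -> size s' <= L ->
  enc_cells L s = enc_cells L s' -> s = s'.
Proof.
move=> l l' /ffunP E; have {}E i : i < L -> nth None (map Some s) i = nth None (map Some s') i.
  by move=> Hi; have := E (Ordinal Hi); rewrite !ffunE.
have sz (r r' : seq (option bool)) : size r <= L -> size r' <= L ->
    (forall i, i < L -> nth None (map Some r) i = nth None (map Some r') i) ->
    size r' <= size r.
  move=> lr lr' Er; rewrite leqNgt; apply/negP => Hlt.
  have := Er (size r) (leq_trans Hlt lr').
  by rewrite nth_default ?size_map // (nth_map None).
have Es : size s = size s'.
  by apply/eqP; rewrite eqn_leq !sz // => i /E.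
apply: (inj_map (@Some_inj _)); apply: (@eq_from_nth _ None); rewrite ?size_map // => i Hi.
by apply: E; apply: leq_trans Hi l.
Qed.

(* Four half tapes of length at most H + 1 over blank, 0, 1 and "absent". *)
Definition node_bound := #|{: tm_state M}| * 4 ^ (4 * H.+1).

Lemma reach_bound (s : seq node) :
  uniq s -> (forall z, z \in s -> reach z) -> size s <= node_bound.
Proof.
move=> us Rs; pose e := @enc_cells H.+1.
pose f (z : node) := (z.1, ((e z.2.1.1, e z.2.1.2), (e z.2.2.1, e z.2.2.2))).
have : uniq (map f s).
  rewrite map_inj_in_uniq // => z z' /Rs/reach_zsize + /Rs/reach_zsize.
  case: z z' => [q [[l r] [l' r']]] [q' [[a b] [a' b']]] /= [h1 h2] [h3 h4].
  rewrite /zsize /= in h1 h2 h3 h4 => E; have -> : q = q' := congr1 fst E.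
  have E1 : e l = e a := congr1 (fun p => p.2.1.1) E.
  have E2 : e r = e b := congr1 (fun p => p.2.1.2) E.
  have E3 : e l' = e a' := congr1 (fun p => p.2.2.1) E.
  have E4 : e r' = e b' := congr1 (fun p => p.2.2.2) E.
  have -> : l = a by apply: (@enc_cells_inj H.+1); [lia | lia | exact: E1].
  have -> : r = b by apply: (@enc_cells_inj H.+1); [lia | lia | exact: E2].
  have -> : l' = a' by apply: (@enc_cells_inj H.+1); [lia | lia | exact: E3].
  by have -> : r' = b' by apply: (@enc_cells_inj H.+1); [lia | lia | exact: E4].
move=> /card_uniqP; rewrite size_map => <-; apply: leq_trans (max_card _) _.
rewrite !card_prod !card_ffun !card_option card_bool card_ord /node_bound.
by rewrite leq_mul2l -!expnD; apply/orP; right; rewrite leq_exp2l //; lia.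
Qed.

End Space.
End Paths.

(** * The table of path counts *)

(* Least significant bit first; canonical means no leading zero. *)
Definition bval (s : seq bool) : nat := foldr (fun (b : bool) a => b + a.*2) 0 s.
Definition canon (s : seq bool) := last true s.

Lemma out_val_rev s : out_val (rev s) = bval s.
Proof. by rewrite /out_val foldl_rev; elim: s => //= b s ->; rewrite addnC. Qed.

Lemma canon_behead s : canon s -> canon (behead s).
Proof. by case: s => // b [|]. Qed.

(** The machine compares tables syntactically. Canonical strings make this the same as comparing the
    numbers, so stable numbers do stop the loop. *)
Lemma canon_inj s s' : canon s -> canon s' -> bval s = bval s' -> s = s'.
Proof.
have nz r : canon r -> bval r = 0 -> r = [::].
  elim: r => // b r IH C /= E; have r0 : r = [::].
    by apply: IH; [exact: canon_behead C | lia].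
  by move: C E; rewrite r0 /canon /= => ->.
elim: s s' => [|b s IH] [|b' s'] C C' //=.
- by move=> E; rewrite (nz (b' :: s')).
- by move=> E; rewrite (nz (b :: s)).
- move=> E; have bb : b = b' by move: E; case: (b); case: (b') => //; lia.
  rewrite bb (IH s') //; [exact: canon_behead C | exact: canon_behead C' |].
  by move: E; rewrite bb; lia.
Qed.

Lemma size_canon s : canon s -> 2 ^ (size s).-1 <= maxn 1 (bval s).
Proof.
elim: s => // b [|b' s] IH C; first by move: C; rewrite /canon /= => ->.
have {IH} := IH (canon_behead C); rewrite [bval (b :: _)]/= -/(bval (b' :: s)).
have : bval (b' :: s) != 0.
  apply/eqP => E; have := @canon_inj (b' :: s) [::] (canon_behead C) isT E; by [].
by rewrite /= -/(bval s) expnS; move: (2 ^ _) => q; lia.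
Qed.

(** * Binary addition as an iterated step *)

Definition adder := ((seq bool * seq bool) * (bool * seq bool))%type.

(** Remaining digits, carry and reversed result. The idle case keeps a finished addition from
    producing leading zeros in surplus steps. *)
Definition bstep (y : adder) : adder :=
  let: ((a, b), (c, r)) := y in
  if [&& nilp a, nilp b & ~~ c] then y else
  let a0 := head false a in let b0 := head false b in
  ((behead a, behead b),
   (if a0 then b0 || c else b0 && c, (a0 (+) b0 (+) c) :: r)).

(** The folded lists serve only as step counters: every step consumes a digit or the carry until
    none is left, so [size a + size b] steps suffice. *)
Definition badd (a b : seq bool) : seq bool :=
  rev (foldl (fun y _ => bstep y) (foldl (fun y _ => bstep y) ((a, b), (false, [::])) a) b).2.2.

(* [adder_val] is invariant under [bstep], and [adder_size] bounds the steps still needed. *)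
Definition adder_val (y : adder) :=
  bval (rev y.2.2) + 2 ^ size y.2.2 * (bval y.1.1 + bval y.1.2 + y.2.1).

Definition adder_ok (y : adder) :=
  [/\ canon y.1.1, canon y.1.2 &
      [&& nilp y.1.1, nilp y.1.2 & ~~ y.2.1] ==> head true y.2.2].

Definition adder_size (y : adder) := size y.1.1 + size y.1.2 + y.2.1.

Lemma bval_rcons s b : bval (rcons s b) = bval s + 2 ^ size s * b.
Proof.
elim: s => [|c s IH] /=; first by rewrite mul1n addn0.
by rewrite IH expnS -!muln2; lia.
Qed.

Lemma bval_head a : bval a = head false a + (bval (behead a)).*2.
Proof. by case: a. Qed.

Lemma bstep_val y : adder_val (bstep y) = adder_val y.
Proof.
case: y => [[a b] [c r]]; rewrite /bstep; case: ifP => // _.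
rewrite /adder_val /= rev_cons bval_rcons size_rev expnS (bval_head a) (bval_head b).
by move: (2 ^ _) => q; case: (head false a); case: (head false b); case: c => /=; lia.
Qed.

(** If a step that is not idle leaves no digits and no carry, exactly one of its three bits was 1:
    at least one because canonical inputs end in 1, at most one because no carry remains. So the
    last digit produced is 1. *)
Lemma bstep_ok y : adder_ok y -> adder_ok (bstep y).
Proof.
case: y => [[a b] [c r]]; rewrite /bstep; case: ifP => // N [/= Ca Cb _].
split=> /=; [exact: canon_behead | exact: canon_behead |].
by case: a N Ca => [|[] [|a1 a]]; case: b Cb => [|[] [|b1 b]]; case: c.
Qed.

Lemma bstep_size y : adder_size (bstep y) <= (adder_size y).-1.
Proof.
case: y => [[a b] [c r]]; rewrite /bstep /adder_size; case: ifP => [|N] /=.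
  by case: a => //; case: b => //; case: c.
by case: a N => [|[] a]; case: b => [|[] b]; case: c => //= _; lia.
Qed.

Lemma foldl_bstep (s : seq bool) y0 : adder_ok y0 ->
  let y := foldl (fun y _ => bstep y) y0 s in
  [/\ adder_val y = adder_val y0, adder_ok y & adder_size y <= adder_size y0 - size s].
Proof.
elim: s y0 => [|d s IH] y0 O; first by rewrite subn0.
have [H1 H2 H3] := IH _ (bstep_ok O); split=> //=; first by rewrite H1 bstep_val.
by apply: leq_trans H3 _; have := bstep_size y0; lia.
Qed.

Lemma badd_spec a b : canon a -> canon b -> canon (badd a b) /\ bval (badd a b) = bval a + bval b.
Proof.
move=> Ca Cb; rewrite /badd -foldl_cat.
set y0 := ((a, b), (false, [::])) : adder; set y := foldl _ _ _.
have [|V O Z] := @foldl_bstep (a ++ b) y0; first by split=> //=; rewrite implybT.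
rewrite -/y in V O Z; clearbody y.
have {}Z : adder_size y = 0.
  by move: Z; rewrite {2}/adder_size /= size_cat; lia.
move: V O Z; case: y => [[[|//] [|//]] [[//|] r]]; rewrite /adder_val /= => V [_ _ /= O] _.
have {}V : bval (rev r) = bval a + bval b by lia.
split=> //.
by rewrite /canon; case: r O {V} => //= d r; rewrite rev_cons last_rcons.
Qed.

(** * Passes over the table and their fixpoints *)

Section Table.
Variables (M : TM) (x : seq bool) (k : nat).
Local Notation node := (node M).
Local Notation kids := (@kids M (x, k)).
Local Notation kidlist := (@kidlist M x k).
Local Notation reach := (@reach M x k).
Local Notation num := (@num M x k).

Definition entry := (node * seq bool)%type.
Definition table := seq entry.
Implicit Type T : table.

Definition keys T := map fst T.
(** A missing key reads as 0, the number with which [addkey] would enter it. *)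
Definition lookup T (z : node) : seq bool :=
  foldl (fun v (e : entry) => if e.1 == z then e.2 else v) [::] T.
Definition known T (z : node) : bool :=
  foldl (fun b (e : entry) => if e.1 == z then true else b) false T.

Definition newval T (z : node) : seq bool :=
  match kids z with
  | OHalt b => if b then [:: true] else [::]
  | OChoose z0 z1 => badd (lookup T z0) (lookup T z1)
  | OStep z' _ => lookup T z'
  end.

(** All new numbers are computed from the old table, so the effect is one simultaneous application
    of [expand]. *)
Definition refresh T : table :=
  rev (foldl (fun s (e : entry) => (e.1, newval T e.1) :: s) [::] T).

Definition addkey T (z : node) : table := if known T z then T else (z, [::]) :: T.

Definition pass T : table :=
  foldl (fun s (e : entry) => foldl addkey s (kidlist e.1)) (refresh T) T.

Lemma refreshE T : refresh T = [seq (e.1, newval T e.1) | e <- T].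
Proof.
rewrite /refresh; move: (newval T) => g.
suff H s : foldl (fun s (e : entry) => (e.1, g e.1) :: s) s T =
    catrev [seq (e.1, g e.1) | e <- T] s by rewrite H -/(rev _) revK.
by elim: T s => //= e T IH s; rewrite IH.
Qed.

Lemma keys_refresh T : keys (refresh T) = keys T.
Proof. by rewrite refreshE /keys -map_comp; apply: eq_map. Qed.

Lemma knownE T z : known T z = (z \in keys T).
Proof.
rewrite /known -[RHS]orFb; elim: T false => [|e T IH] b /=; first by rewrite orbF.
by rewrite IH inE eq_sym; case: ifP; case: b.
Qed.

Lemma lookup_out T z : z \notin keys T -> lookup T z = [::].
Proof.
rewrite /lookup; elim: T [::] => //= e T IH v.
by rewrite inE negb_or eq_sym => /andP[/negbTE-> /IH].
Qed.

Lemma lookup_in T e : uniq (keys T) -> e \in T -> lookup T e.1 = e.2.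
Proof.
have out T' v z : z \notin keys T' ->
    foldl (fun v (e : entry) => if e.1 == z then e.2 else v) v T' = v.
  elim: T' v => //= e' T' IH v.
  by rewrite inE negb_or eq_sym => /andP[/negbTE-> /IH].
rewrite /lookup; elim: T [::] => //= e' T IH v /andP[N U]; rewrite inE => /orP[/eqP->|He].
  by rewrite eqxx out.
exact: IH.
Qed.

Lemma passE T : pass T = foldl addkey (refresh T) (flatten [seq kidlist e.1 | e <- T]).
Proof.
rewrite /pass; move: (refresh T) => s.
by elim: T s => //= e T IH s; rewrite foldl_cat IH.
Qed.

Lemma foldl_addkey T (zs : seq node) : uniq (keys T) ->
  let T' := foldl addkey T zs in
  [/\ uniq (keys T'), {subset keys T <= keys T'},
      forall e, e \in T' -> e \in T \/ e.1 \in zs /\ e.2 = [::],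
      size T <= size T' &
      size T' = size T -> T' = T /\ {subset zs <= keys T}].
Proof.
elim: zs T => [|z zs IH] T U /=; first by split=> // e; left.
have U1 : uniq (keys (addkey T z)).
  by rewrite /addkey knownE; case: ifP => //= ->.
have S1 : {subset keys T <= keys (addkey T z)}.
  move=> z' Hz'; rewrite /addkey; case: ifP => // _.
  by rewrite /keys [map _ _]/= in_cons Hz' orbT.
have [H1 H2 H3 H4 H5] := IH _ U1; split=> //.
- by move=> z' /S1/H2.
- move=> e /H3[|[He E]]; last by right; rewrite inE He orbT.
  rewrite /addkey; case: ifP => _; first by left.
  by rewrite inE => /orP[/eqP->|]; [right; rewrite inE eqxx | left].
- by apply: leq_trans H4; rewrite /addkey; case: ifP.
- move=> E; move: H4 H5; rewrite {}E /addkey knownE; case: ifP => [Hz _ /(_ erefl)[-> H]|_].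
    by split=> // z'; rewrite inE => /orP[/eqP->|/H].
  by rewrite /= ltnn.
Qed.

Definition closed T := forall z z', z \in keys T -> z' \in kidlist z -> z' \in keys T.

Section Bounds.
Variable S : nat.
Hypothesis stable : forall t z, reach z -> num t z <= num S z.
Hypothesis card : forall s : seq node, uniq s -> (forall z, z \in s -> reach z) -> size s <= S.

(** The invariant of all passes. Its upper bound is what excludes spurious solutions around
    cycles. *)
Definition sound T :=
  [/\ uniq (keys T), node0 M \in keys T &
      forall e, e \in T -> [/\ reach e.1, canon e.2 & bval e.2 <= num S e.1]].

Lemma sound_lookup T z : sound T -> canon (lookup T z) /\ bval (lookup T z) <= num S z.
Proof.
move=> [U _ H]; have [/mapP[e He ->]|/lookup_out->//] := boolP (z \in keys T).
by rewrite lookup_in //; have [_ ? ?] := H e He.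
Qed.

Lemma newval_spec T z : sound T ->
  canon (newval T z) /\ bval (newval T z) = expand x k (fun z => bval (lookup T z)) z.
Proof.
move=> ST; rewrite /newval /expand; case: (kids z) => [[]|z0 z1|z' _] //.
- have [C0 _] := sound_lookup z0 ST; have [C1 _] := sound_lookup z1 ST.
  exact: badd_spec.
- by have [] := sound_lookup z' ST.
Qed.

(** By stability, S + 1 steps accept no more than S steps do; hence the true numbers solve the
    equations. *)
Lemma expand_num z : reach z -> expand x k (num S) z = num S z.
Proof.
move=> R; apply/eqP; rewrite -numS eqn_leq stable //=.
exact: num_mono.
Qed.

Lemma sound_pass T : sound T -> sound (pass T).
Proof.
move=> ST; have [U N0 H] := ST; rewrite passE.
have U1 : uniq (keys (refresh T)) by rewrite keys_refresh.
have [H1 H2 H3 _ _] := foldl_addkey (flatten [seq kidlist e.1 | e <- T]) U1.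
split=> //; first by apply: H2; rewrite keys_refresh.
move=> e /H3[|[/flattenP[_ /mapP[e' He' ->] He] ->]].
- rewrite refreshE => /mapP[e' He' ->] /=; have [R _ _] := H e' He'.
  have [C ->] := newval_spec e'.1 ST; split=> //.
  rewrite -(expand_num R); apply: leq_expand => z' _.
  by have [] := sound_lookup z' ST.
- by have [R _ _] := H e' He'; split=> //; apply: reach_kid R He.
Qed.

Lemma sound_size T : sound T -> size T <= S.
Proof.
move=> [U _ H]; rewrite -(size_map fst); apply: card => // z /mapP[e He ->].
by have [] := H e He.
Qed.

Lemma size_refresh T : size (refresh T) = size T.
Proof. by rewrite refreshE size_map. Qed.

Lemma size_pass T : uniq (keys T) -> size T <= size (pass T).
Proof.
rewrite -(keys_refresh T) => U; rewrite passE -{1}(size_refresh T).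
by have [] := foldl_addkey (flatten [seq kidlist e.1 | e <- T]) U.
Qed.

Lemma size_pass_closed T : uniq (keys T) -> size (pass T) = size T -> closed T.
Proof.
rewrite -{1}(keys_refresh T) => U; rewrite passE -(size_refresh T).
have [_ _ _ _ H] := foldl_addkey (flatten [seq kidlist e.1 | e <- T]) U.
case/H=> _ Hs z z' /mapP[e He ->] Hz'; rewrite -keys_refresh; apply: Hs.
by apply/flattenP; exists (kidlist e.1) => //; apply: map_f.
Qed.

Lemma closed_pass T : uniq (keys T) -> closed T -> pass T = refresh T.
Proof.
move=> U C; rewrite passE.
have : {subset flatten [seq kidlist e.1 | e <- T] <= keys (refresh T)}.
  move=> z /flattenP[_ /mapP[e He ->] Hz]; rewrite keys_refresh.
  by apply: C Hz; apply: map_f.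
elim: (flatten _) (refresh T) => //= z zs IH T' Hs.
rewrite {2}/addkey knownE Hs ?inE ?eqxx //; apply: IH => z' Hz'.
by apply: Hs; rewrite inE Hz' orbT.
Qed.

(* Each pass over a closed table accounts for accepting paths with one more configuration. *)
Definition level i T := forall z, z \in keys T -> num i z <= bval (lookup T z).

Lemma level_pass i T : sound T -> closed T -> level i T -> level i.+1 (pass T).
Proof.
move=> ST C L; have [U _ H] := ST; rewrite closed_pass // => z.
rewrite keys_refresh => Hz.
have He : (z, newval T z) \in refresh T.
  by rewrite refreshE; case/mapP: Hz => e He ->; apply: (map_f (fun e => (e.1, newval T e.1))).
rewrite [lookup _ z](lookup_in _ He) ?keys_refresh //=.
have [_ ->] := newval_spec z ST; rewrite numS; apply: leq_expand => z' Hz'.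
by apply: L; apply: C Hz'.
Qed.

(** [level S] from below and [sound] from above fix all values, so a pass recomputes the same
    values, and canonicity turns equal values into equal strings. *)
Lemma level_fixpoint T : sound T -> closed T -> level S T -> pass T = T.
Proof.
move=> ST C L; have [U _ H] := ST; rewrite closed_pass // refreshE -[RHS]map_id.
apply/eq_in_map => e He; rewrite [RHS]surjective_pairing; congr pair.
have [R Ce Be] := H e He; have [Cn Bn] := newval_spec e.1 ST.
apply: canon_inj => //; rewrite Bn.
have He1 : e.1 \in keys T by apply: map_f.
have eqL z : z \in keys T -> bval (lookup T z) = num S z.
  move=> Hz; apply/eqP; rewrite eqn_leq L // andbT.
  by have [] := sound_lookup z ST.
rewrite -[e.2](lookup_in U He) eqL // -expand_num //.
apply/eqP; rewrite eqn_leq; apply/andP; split; apply: leq_expand => z' Hz'.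
- by rewrite eqL //; apply: C Hz'.
- by rewrite eqL //; apply: C Hz'.
Qed.

Lemma closed_closed_pass T : uniq (keys T) -> closed T -> closed (pass T).
Proof. by move=> U C; rewrite closed_pass // => z z'; rewrite keys_refresh; apply: C. Qed.

(** There are two phases. While keys are missing ([B]), each pass enlarges a table that never
    exceeds S entries; once the table is closed ([A]), S passes lift the level from 0 to S. *)
Lemma pass_terminates T : sound T -> exists2 n, n <= S.*2.+1 & pass (iter n pass T) = iter n pass
    T.
Proof.
have A j i T' : sound T' -> closed T' -> level i T' -> S <= i + j ->
    exists2 n, n <= j & pass (iter n pass T') = iter n pass T'.
  elim: j i T' => [|j IH] i T' ST C L le.
    exists 0 => //; apply: level_fixpoint => // z Hz.
    by apply: leq_trans (L z Hz); apply: num_mono; rewrite addn0 in le.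
  have [U _ _] := ST.
  have [|n Hn E] := IH i.+1 _ (sound_pass ST) (closed_closed_pass U C) (level_pass ST C L).
    by rewrite addSnnS.
  by exists n.+1 => //; rewrite iterSr.
suff B j T' : sound T' -> S < size T' + j ->
    exists2 n, n <= j + S & pass (iter n pass T') = iter n pass T'.
  move=> ST; have [|n Hn E] := B S.+1 T ST; first by rewrite addnS ltnS leq_addl.
  by exists n => //; apply: leq_trans Hn _; rewrite addSn addnn.
elim: j T' => [|j IH] T' ST; first by rewrite addn0 ltnNge (sound_size ST).
move=> le; have [U _ _] := ST.
have := size_pass U; rewrite leq_eqVlt => /orP[/eqP E|lt].
  have [//|//|n Hn E'] := A S 0 T' ST (size_pass_closed U (esym E)).
  by exists n => //; lia.
have [|n Hn E] := IH _ (sound_pass ST); first by lia.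
by exists n.+1; [lia | rewrite iterSr].
Qed.

(** A fixpoint gains no key, hence is closed; a pass raises its level without changing it, so it has
    every level, S in particular. *)
Lemma fixpoint_num T : sound T -> pass T = T -> bval (lookup T (node0 M)) = num S (node0 M).
Proof.
move=> ST E; have [U N0 _] := ST.
have C : closed T by apply: size_pass_closed => //; rewrite E.
have L i : level i T.
  by elim: i => [//|i IH]; rewrite -E; apply: level_pass.
by apply/eqP; rewrite eqn_leq L // andbT; have [] := sound_lookup (node0 M) ST.
Qed.

Lemma sound_size_val T e : sound T -> e \in T -> size e.2 <= S.+1.
Proof.
move=> [_ _ H] /H[_ C B]; have le := leq_trans B (num_leq_exp x k S e.1).
have : 2 ^ (size e.2).-1 <= 2 ^ S.
  by apply: leq_trans (size_canon C) _; rewrite geq_max le expn_gt0.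
by rewrite leq_exp2l //; lia.
Qed.

Lemma sound0 : sound [:: (node0 M, [::])].
Proof.
split=> [//||e]; rewrite inE // => /eqP->.
by split=> //; apply: reach0.
Qed.

End Bounds.
End Table.

(** * The counting program *)

Definition tlookup (T z : tree) : tree :=
  tfold (fun y => if tbool (teqb (thd (thd y)) (ttl (ttl y))) is tnil
                  then thd (ttl y) else ttl (thd y)) T tnil z.

Definition tknown (T z : tree) : tree :=
  tfold (fun y => if tbool (teqb (thd (thd y)) (ttl (ttl y))) is tnil
                  then thd (ttl y) else tbool true) T tnil z.

Lemma polytime_lookup T z : polytime T -> polytime z ->
    polytime (fun X t => tlookup (T X t) (z X t)).
Proof.
move=> PT Pz; apply: (@polytime_fold (fun _ y => if tbool (teqb (thd (thd y)) (ttl (ttl y))) is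
    tnil
  then thd (ttl y) else ttl (thd y))); prove_polytime.
exists 1 => _ a s e /=; rewrite expn1; case: (tbool _) => [|_ _]; first exact: leq_addr.
by have := tsz_ttl a; lia.
Qed.

Lemma polytime_known T z : polytime T -> polytime z ->
    polytime (fun X t => tknown (T X t) (z X t)).
Proof.
move=> PT Pz; apply: (@polytime_fold (fun _ y => if tbool (teqb (thd (thd y)) (ttl (ttl y))) is
    tnil
  then thd (ttl y) else tbool true)); prove_polytime.
exists 1 => _ a s e /=; rewrite expn1; case: (tbool _) => [|_ _]; first exact: leq_addr.
by have := tsz_gt0 a; rewrite /tsz /=; lia.
Qed.

(** The carry and sum bits of [bstep] are spelled out as truth tables, since the only branching
    available is the emptiness test. *)
Definition tbstep (y : tree) : tree :=
  let s := thd (ttl y) in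
  let a := thd s in let b := thd (ttl s) in
  let c := thd (ttl (ttl s)) in let r := ttl (ttl (ttl s)) in
  let t1 := tbool true in
  let next := tcons (ttl a) (tcons (ttl b) (tcons
    (if thd a is tnil then (if thd b is tnil then tnil else (if c is tnil then tnil else t1))
     else (if thd b is tnil then (if c is tnil then tnil else t1) else t1))
    (tcons
    (if thd a is tnil then
       (if thd b is tnil then (if c is tnil then tnil else t1) else (if c is tnil then t1 else
           tnil))
     else
       (if thd b is tnil then (if c is tnil then t1 else tnil) else (if c is tnil then tnil else
           t1)))
    r))) in
  if a is tnil then (if b is tnil then (if c is tnil then s else next) else next) else next.

Lemma polytime_bstep : polytime (fun _ => tbstep).
Proof. by rewrite /tbstep; prove_polytime. Qed.

Lemma slow_bstep : slow_growth (fun _ => tbstep).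
Proof.
exists 5 => _ a s e.
apply: (@leq_trans (tsz s + 4 ^ 5)); last first.
  by rewrite leq_add2l; apply: leq_expn2r; have := tsz_gt0 a; have := tsz_gt0 e; lia.
rewrite /tbstep [thd (ttl _)]/=; set m := (X in tcons _ (tcons _ (tcons X _))).
set d := (X in tcons _ (tcons _ (tcons _ (tcons X _)))).
have Hm : tsz m <= 3.
  rewrite /m; case: (thd (thd s)); case: (thd (thd (ttl s)));
    by move=> *; case: (thd (ttl (ttl s))).
have Hd : tsz d <= 3.
  rewrite /d; case: (thd (thd s)); case: (thd (thd (ttl s)));
    by move=> *; case: (thd (ttl (ttl s))).
set next := tcons _ _.
have Hn : tsz next <= tsz s + 4 ^ 5.
  rewrite /next !tsz_cons.
  have := tsz_ttl (thd s); have := tsz_ttl (thd (ttl s)).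
  suff : tsz (thd s) + tsz (thd (ttl s)) + tsz (ttl (ttl (ttl s))) <= tsz s + 3.
    by rewrite (_ : 4 ^ 5 = 1024) //; lia.
  by case: s {m d next Hm Hd} => [|a0 [|b0 [|c0 r0]]] //=; rewrite !tsz_cons /=;
    try have := tsz_gt0 c0; rewrite /tsz /=; lia.
by case: (thd s) => *; last exact: Hn; case: (thd (ttl s)) => *; last exact: Hn;
   case: (thd (ttl (ttl s))) => *; [exact: leq_addr | exact: Hn].
Qed.

Definition tadder (y : adder) : tree :=
  tcons (tlist tbool y.1.1) (tcons (tlist tbool y.1.2) (tcons (tbool y.2.1) (tlist tbool y.2.2))).

Lemma tbstepE a y e : tbstep (tcons a (tcons (tadder y) e)) = tadder (bstep y).
Proof.
by case: y => [[[|[] u] [|[] v]] [[] r]].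
Qed.

Definition tbadd (u v : tree) : tree :=
  trevapp (ttl (ttl (ttl (tfold tbstep v
    (tfold tbstep u (tcons u (tcons v (tcons tnil tnil))) tnil) tnil)))) tnil.

Lemma tbaddE u v : tbadd (tlist tbool u) (tlist tbool v) = tlist tbool (badd u v).
Proof.
rewrite /tbadd -[tcons _ _]/(tadder ((u, v), (false, [::]))).
rewrite (@tfold_tlist _ _ _ tadder (fun y _ => bstep y)) => [|a s]; last exact: tbstepE.
rewrite (@tfold_tlist _ _ _ tadder (fun y _ => bstep y)) => [|a s]; last exact: tbstepE.
by rewrite [ttl (ttl _)]/= (trevappE tbool _ [::]) cats0.
Qed.

Lemma polytime_badd u v : polytime u -> polytime v -> polytime (fun X t => tbadd (u X t) (v X t)).
Proof.
move=> Pu Pv; apply: polytime_revapp; prove_polytime.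
apply: (polytime_fold polytime_bstep slow_bstep); prove_polytime.
by apply: (polytime_fold polytime_bstep slow_bstep); prove_polytime.
Qed.

Section Pass.
Variable M : TM.

Definition tnewval (X : input) (T z : tree) : tree :=
  let r := tkids M X z in
  if thd r is tnil then (if ttl r is tnil then tnil else tcons (tbool true) tnil)
  else if ttl (thd r) is tnil then tbadd (tlookup T (thd (ttl r))) (tlookup T (ttl (ttl r)))
  else tlookup T (thd (ttl r)).

Lemma polytime_newval T z : polytime T -> polytime z ->
    polytime (fun X t => tnewval X (T X t) (z X t)).
Proof.
move=> PT Pz; have Pk := polytime_tkids M Pz; rewrite /tnewval; prove_polytime.
- by apply: polytime_badd; apply: polytime_lookup; prove_polytime.
- by apply: polytime_lookup; prove_polytime.
Qed.

Definition trefresh (X : input) (T : tree) : tree :=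
  trevapp (tfold (fun y => tcons (tcons (thd (thd y))
    (tnewval X (ttl (ttl y)) (thd (thd y)))) (thd (ttl y))) T tnil T) tnil.

Lemma polytime_refresh T : polytime T -> polytime (fun X t => trefresh X (T X t)).
Proof.
move=> PT; apply: polytime_revapp; prove_polytime.
apply: (@polytime_fold (fun X y => tcons (tcons (thd (thd y))
    (tnewval X (ttl (ttl y)) (thd (thd y)))) (thd (ttl y)))); prove_polytime.
  by apply: polytime_newval; prove_polytime.
(* The new entry depends on the list element and the environment only, so its size is bounded
   independently of the accumulator, as slow growth requires. *)
have : polytime (fun X y => tcons (thd (thd y)) (tnewval X (ttl y) (thd (thd y)))).
  by prove_polytime; apply: polytime_newval; prove_polytime.
case/polytime_elim=> c [g [Pg M' _ Hg]].
have [k Hk] : polybounded (fun n => g n.+1 + 1) by apply: polybounded_add (polybounded_const 1);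
  apply: (@polybounded_comp g S) => //; apply: (@polybounded_leq _ (fun n => 1 + n)) => //;
  apply: polybounded_add (polybounded_const 1) polybounded_id.
exists k => X a s e; have := Hg X (tcons a e); have := Hk (tsz a + tsz e).
by rewrite !tsz_cons /=; lia.
Qed.

Definition taddkey (T z : tree) : tree := if tknown T z is tnil then tcons (tcons z tnil) T else
    T.

Lemma polytime_addkey T z : polytime T -> polytime z ->
    polytime (fun X t => taddkey (T X t) (z X t)).
Proof. by move=> PT Pz; have Pk := polytime_known PT Pz; rewrite /taddkey; prove_polytime. Qed.

Lemma tsz_addkey T z : tsz (taddkey T z) <= tsz T + tsz z + 3.
Proof.
by rewrite /taddkey; case: (tknown _ _) => [|_ _]; rewrite ?tsz_cons /tsz /=; lia.
Qed.

Definition taddkids (X : input) (y : tree) : tree :=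
  let r := tkids M X (thd (thd y)) in
  let s := thd (ttl y) in
  if thd r is tnil then s
  else if ttl (thd r) is tnil then taddkey (taddkey s (thd (ttl r))) (ttl (ttl r))
  else taddkey s (thd (ttl r)).

Lemma polytime_addkids : polytime taddkids.
Proof.
have Pk : polytime (fun X y => tkids M X (thd (thd y))) by apply: polytime_tkids; prove_polytime.
rewrite /taddkids; prove_polytime.
- by apply: polytime_addkey; prove_polytime; apply: polytime_addkey; prove_polytime.
- by apply: polytime_addkey; prove_polytime.
Qed.

(** At most two entries are added, and their keys come from [tkids] applied to the list element; the
    accumulator decides only whether they are added. *)
Lemma slow_addkids : slow_growth taddkids.
Proof.
have [c [g [Pg Mg _ Hg]]] := polytime_elim (polytime_tkids M polytime_id).
have [k Hk] : polybounded (fun n => 2 * g n + 6).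
  exact: polybounded_add (polybounded_mul (polybounded_const 2) Pg) (polybounded_const 6).
exists k => X a s e; rewrite /taddkids [thd (thd _)]/= [thd (ttl _)]/=.
set r := tkids M X (thd a).
have Hr : tsz r <= g (tsz a + tsz e).
  apply: leq_trans (Hg X (thd a)) _; apply: Mg; apply: leq_trans (tsz_thd a) _.
  exact: leq_addr.
have := Hk (tsz a + tsz e) => {}Hk.
have H1 := leq_trans (tsz_thd (ttl r)) (tsz_ttl r).
have H2 := leq_trans (tsz_ttl (ttl r)) (tsz_ttl r).
have := tsz_addkey s (thd (ttl r)).
have := tsz_addkey (taddkey s (thd (ttl r))) (ttl (ttl r)).
by case: (thd r) => [|t0 [|t1 t2]] /=; lia.
Qed.

Definition tpass (X : input) (T : tree) : tree :=
  tfold (taddkids X) T (trefresh X T) tnil.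

Lemma polytime_pass T : polytime T -> polytime (fun X t => tpass X (T X t)).
Proof.
move=> PT; apply: (polytime_fold polytime_addkids slow_addkids); prove_polytime.
exact: polytime_refresh.
Qed.

Definition tround (X : input) (y : tree) : tree :=
  tcons (if tbool (teqb (tpass X (ttl y)) (ttl y)) is tnil then tbool true else tnil)
        (tpass X (ttl y)).

Lemma polytime_round : polytime tround.
Proof. by have PT := polytime_pass (polytime_tl polytime_id); rewrite /tround;
    prove_polytime. Qed.

Section Encoding.
Variables (x : seq bool) (k : nat).
Local Notation X := (x, k).

Definition tentry (e : entry M) : tree := tcons (tnode e.1) (tlist tbool e.2).
Definition ttable (T : table M) : tree := tlist tentry T.

Lemma ttable_inj : injective ttable.
Proof.
apply: tlist_inj => -[z v] [z' v'] E.
have /tnode_inj -> : tnode z = tnode z' := congr1 thd E.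
by have /(tlist_inj tbool_inj) -> : tlist tbool v = tlist tbool v' := congr1 ttl E.
Qed.

Lemma teqb_node (z z' : node M) : teqb (tnode z) (tnode z') = (z == z').
Proof. by apply/teqbP/eqP => [/tnode_inj|->]. Qed.

Lemma tlookupE T z : tlookup (ttable T) (tnode z) = tlist tbool (lookup T z).
Proof.
rewrite /tlookup (@tfold_tlist _ _ _ (tlist tbool)
  (fun v (e : entry M) => if e.1 == z then e.2 else v) _ _ T [::]) // => e v /=.
by rewrite teqb_node; case: eqP.
Qed.

Lemma tknownE T z : tknown (ttable T) (tnode z) = tbool (known T z).
Proof.
rewrite /tknown (@tfold_tlist _ _ _ tbool
  (fun v (e : entry M) => if e.1 == z then true else v) _ _ T false) // => e v /=.
by rewrite teqb_node; case: eqP.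
Qed.

Lemma tnewvalE T z : tnewval X (ttable T) (tnode z) = tlist tbool (newval x k T z).
Proof.
rewrite /tnewval tkidsE /newval; case: (kids X z) => [[]|z0 z1|z' e] //.
- by rewrite [thd _]/= [ttl _]/= !tlookupE tbaddE.
- by rewrite [thd _]/= [ttl _]/= tlookupE.
Qed.

Lemma trefreshE T : trefresh X (ttable T) = ttable (refresh x k T).
Proof.
rewrite /trefresh (@tfold_tlist _ _ _ ttable
  (fun s (e : entry M) => (e.1, newval x k T e.1) :: s) _ _ T [::]) => [|e s].
  by rewrite (trevappE tentry _ [::]) cats0.
by rewrite [thd (thd _)]/= [ttl (ttl _)]/= tnewvalE.
Qed.

Lemma taddkeyE T z : taddkey (ttable T) (tnode z) = ttable (addkey T z).
Proof. by rewrite /taddkey tknownE /addkey; case: (known T z). Qed.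

Lemma taddkidsE e T t : taddkids X (tcons (tentry e) (tcons (ttable T) t)) =
  ttable (foldl (@addkey M) T (kidlist x k e.1)).
Proof.
rewrite /taddkids [thd (thd _)]/= tkidsE /kidlist; case: (kids X e.1) => [[]|z0 z1|z' o] //.
- by rewrite [thd _]/= [ttl _]/= !taddkeyE.
- by rewrite [thd _]/= [ttl _]/= !taddkeyE.
Qed.

Lemma tpassE T : tpass X (ttable T) = ttable (pass x k T).
Proof.
rewrite /tpass trefreshE (@tfold_tlist _ _ _ ttable
  (fun s (e : entry M) => foldl (@addkey M) s (kidlist x k e.1))) // => e s.
exact: taddkidsE.
Qed.

Lemma troundE f T : tround X (tcons f (ttable T)) =
  tcons (tbool (pass x k T != T)) (ttable (pass x k T)).
Proof.
rewrite /tround [ttl _]/= tpassE; congr tcons.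
have -> : teqb (ttable (pass x k T)) (ttable T) = (pass x k T == T).
  by apply/teqbP/eqP => [/ttable_inj|->].
by case: (_ == _).
Qed.

(** Up to n rounds reach the fixpoint and one more round notices it. If it is met earlier, the
    remaining iterations of [pass] change nothing. *)
Lemma exec_loop_rounds c g d o W n T : realizes c tround g -> {homo g : a b / a <= b} ->
  (forall i, tsz (ttable (iter i (pass x k) T)) + 4 <= W) ->
  pass x k (iter n (pass x k) T) = iter n (pass x k) T ->
  exists2 m, m <= n.+1 * (g W + 10) + 10 &
    exec_loop X c (tcons (tbool true) (ttable T)) d o
      (on_D (enc (tcons tnil (ttable (iter n (pass x k) T))) ++ d) o) m.
Proof.
move=> H Mg; elim: n T => [|n IH] T HW E.
all: have L : g (tsz (tcons (tbool true) (ttable T))) <= g W by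
  apply: Mg; rewrite tsz_cons; have := HW 0; rewrite /= /tsz /=; lia.
all: have stop : pass x k T = T -> exec_loop X c (tcons (tbool true) (ttable T)) d o
  (on_D (enc (tcons tnil (ttable T)) ++ d) o) (g W + 10 + 10).
1, 3: move=> E1; apply: (@exec_while_leq _ _ _ _ _ (g (tsz (tcons (tbool true) (ttable T))) + 10
    + 10));
  first (by lia); apply: exec_loop_step; [by [] | exact: H |];
  by rewrite troundE E1 eqxx; apply: exec_loop_stop.
  by exists (g W + 10 + 10); [rewrite mul1n | exact: stop].
have [E1|N] := altP (pass x k T =P T).
  exists (g W + 10 + 10); first by rewrite mulSn; lia.
  by rewrite iter_fix //; exact: stop.
have [i||n1 Hn W1] := IH (pass x k T); [by rewrite -iterSr | by rewrite -iterSr |].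
exists (g W + n1 + 10); first by rewrite mulSn; lia.
apply: (@exec_while_leq _ _ _ _ _ (g (tsz (tcons (tbool true) (ttable T))) + n1 + 10));
    first by lia.
apply: exec_loop_step; [by [] | exact: H |].
by rewrite troundE N iterSr.
Qed.

End Encoding.
End Pass.

Lemma tsz_tbool b : tsz (tbool b) <= 3. Proof. by case: b. Qed.

Lemma exec_loop_print X ch gh ct gt W l d o :
  realizes ch (fun _ y => thd (thd y)) gh -> {homo gh : a b / a <= b} ->
  realizes ct (fun _ y => tcons (ttl (thd y)) tnil) gt -> {homo gt : a b / a <= b} ->
  tsz (tcons (tlist tbool l) tnil) <= W ->
  exec_loop X (Seq dup (Seq ch (Seq (if_tree (emit false) (emit true)) ct)))
    (tcons (tlist tbool l) tnil) d o (on_D (enc (tcons tnil tnil) ++ d) (o ++ l))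
    (size l * (30 * W + gh W + gt W + 60) + 10).
Proof.
move=> Hh Mh Ht Mt; elim: l o => [|b l IH] o HW.
  by rewrite cats0; apply: exec_loop_stop.
have Hh1 := Mh _ _ HW; have Ht1 := Mt _ _ HW.
have HW' : tsz (tcons (tlist tbool l) tnil) <= W.
  apply: leq_trans HW; rewrite (tsz_cons (tlist tbool l)) (tsz_cons (tlist _ (b :: l))).
  by have := tsz_ttl (tlist tbool (b :: l)); rewrite [ttl _]/=; lia.
set y := tcons _ _ in HW Hh1 Ht1 *.
(* The 46 is [1 + 15 * 3]: [emit], and [if_tree] on an encoded bit, whose size is at most 3. *)
apply: (@exec_while_leq _ _ _ _ _ ((30 * tsz y + (gh (tsz y) + (46 + gt (tsz y)))) +
   (size l * (30 * W + gh W + gt W + 60) + 10) + 10)).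
  by rewrite [size (b :: l)]/= (mulSn (size l)); clearbody y; move: (size l * _) => q; lia.
apply: exec_loop_step; [by [] | | by have := IH (rcons o b) HW'; rewrite cat_rcons; apply].
apply: exec_Seq; first exact: exec_dup.
apply: exec_Seq; first exact: Hh.
apply: (@exec_Seq _ _ _ _ (on_D (enc y ++ d) (rcons o b))); last exact: Ht.
apply: (@exec_leq _ _ _ _ (1 + 15 * tsz (tbool b))); first by have := tsz_tbool b; lia.
rewrite -[thd (thd _)]/(tbool b); apply: exec_if_tree; clear.
by move: (enc y ++ d) => s; clear; case: b; apply: exec_emit.
Qed.

Lemma tsz_tlist (A : eqType) (f : A -> tree) l m :
  (forall a, a \in l -> tsz (f a) <= m) -> tsz (tlist f l) <= size l * m.+1 + 1.
Proof.
elim: l => //= a l IH H; rewrite tsz_cons mulSn.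
have := H a (mem_head _ _).
suff : tsz (tlist f l) <= size l * m.+1 + 1 by lia.
by apply: IH => a' Ha'; apply: H; rewrite inE Ha' orbT.
Qed.

Lemma tsz_bits l : tsz (tlist tbool l) <= size l * 4 + 1.
Proof. by apply: tsz_tlist => b _; apply: tsz_tbool. Qed.

Lemma tsz_zip z : tsz (tzip z) <= 6 * zsize z + 3.
Proof.
have H l : tsz (tlist tcell l) <= size l * 6 + 1 by apply: tsz_tlist => -[[]|].
by rewrite tsz_cons; have := H z.1; have := H z.2; rewrite /zsize; lia.
Qed.

Lemma tsz_node M (z : node M) :
  tsz (tnode z) <= 2 * #|{: tm_state M}| + 6 * zsize z.2.1 + 6 * zsize z.2.2 + 9.
Proof.
rewrite /tnode (tsz_cons (tstate _)) (tsz_cons (tzip _)); have := tsz_zip z.2.1;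
    have := tsz_zip z.2.2.
have : tsz (tstate z.1) <= size (nseq (enum_rank z.1) tt) * 2 + 1 by apply: tsz_tlist.
rewrite size_nseq.
have [i -> Hi] : exists2 i : nat, nat_of_ord (enum_rank z.1) = i & i < #|{: tm_state M}|.
  by exists (enum_rank z.1); last exact: ltn_ord.
by move: Hi; move: #|_| => q; lia.
Qed.

Lemma node_bound_ge M H : #|{: tm_state M}| <= node_bound M H /\ H.+1 <= node_bound M H.
Proof.
have Q0 : 0 < #|{: tm_state M}| by apply/card_gt0P; exists (tm_start M).
have E := ltn_expl (4 * H.+1) (isT : 1 < 4).
by rewrite /node_bound; move: E; move: (4 ^ _) => q; split; nia.
Qed.

(** * Size of the table and running time of the program *)

Definition table_bound S := S * (18 * S + 16) + 8.

Lemma tsz_table M x k H S (T : table M) :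
  (forall c n, t_head (cf_work (conf_at M x k c n)) <= H /\
               t_head (cf_index (conf_at M x k c n)) <= H) ->
  S = node_bound M H -> sound x k S T -> size T <= S -> tsz (ttable T) + 4 <= table_bound S.
Proof.
move=> heads ES ST HT; rewrite /table_bound.
suff : tsz (ttable T) <= size T * (18 * S + 16) + 1.
  have L : size T * (18 * S + 16) <= S * (18 * S + 16) by rewrite leq_mul2r HT orbT.
  by lia.
(* The node of an entry has size at most 14S + 9, because S bounds both the number of control states
   and the tape length H + 1; its number has at most S + 1 bits, of encoded size at most 4S + 5.
   Pairing adds 1. *)
rewrite (_ : 18 * S + 16 = (18 * S + 15).+1); last by lia.
apply: tsz_tlist => e He; rewrite tsz_cons.
have := sound_size_val ST He; have [_ _ /(_ e He)[R _ _]] := ST.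
have := reach_zsize heads R; have := tsz_node e.1; have := tsz_bits e.2.
have := node_bound_ge M H; rewrite -ES.
move: (tsz (tnode e.1)) (tsz (tlist tbool e.2)) (size e.2) (zsize e.1.2.1) (zsize e.1.2.2) => a b
    s z1 z2.
move: #|_| => q; lia.
Qed.

(** The order of quantifiers is the point: c and e are fixed before x, k and the bounds on the run,
    so the program is uniform and its time is a fixed polynomial in the number of configurations. *)
Lemma counting_program (M : TM) : exists c e, forall x k H B F,
  (forall c n, t_head (cf_work (conf_at M x k c n)) <= H /\
               t_head (cf_index (conf_at M x k c n)) <= H) ->
  (forall c n, size c - size (cf_choices (conf_at M x k c n)) <= B) ->
  num_acc M x k F ->
  exists t, [/\ t <= (node_bound M H + 2) ^ e, halted (conf_at (program c) x k [::] t) &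
    out_val (cf_output (conf_at (program c) x k [::] t)) = F].
Proof.
have [c1 [g1 [P1 M1 R1 _]]] := polytime_elim (polytime_round M).
(* The number is reversed before printing: the table stores the least significant bit first, the
   output has the most significant bit first. *)
have Pv : polytime (fun _ y => tcons (trevapp (tlookup (ttl y) (tnode (node0 M))) tnil) tnil).
  by prove_polytime; apply: polytime_revapp; prove_polytime; apply: polytime_lookup;
      prove_polytime.
have [c2 [g2 [P2 M2 R2 _]]] := polytime_elim Pv.
have [ch [gh [Ph Mh Rh _]]] := polytime_elim (polytime_hd (polytime_hd polytime_id)).
have [ct [gt [Pt Mt Rt _]]] := polytime_elim (polytime_cons (polytime_tl (polytime_hd
    polytime_id)) polytime_nil).
pose y0 := tcons (tbool true) (ttable [:: (node0 M, [::])]).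
pose main := Seq (pushes (enc y0)) (Seq (twhile c1) (Seq c2
  (twhile (Seq dup (Seq ch (Seq (if_tree (emit false) (emit true)) ct)))))).
(* [W] bounds the tables and [V] the result with its at most S + 1 bits. At most 2S + 1 passes and
   one to notice the fixpoint give the factor [2 * S + 2]. *)
pose W := table_bound; pose V S := 4 * S + 10.
pose cost S := (size (enc y0)).+1 + ((2 * S + 2) * (g1 (W S) + 10) + 12 + (g2 (W S) +
  ((S + 1) * (30 * V S + gh (V S) + gt (V S) + 60) + 12))).
have [e He] : polybounded (fun S => 40 * cost S * (cost S + 1) + 2).
  have PW : polybounded W.
    by repeat first [exact: polybounded_const | exact: polybounded_id | apply: polybounded_add |
        apply: polybounded_mul].
  have PV : polybounded V.
    by repeat first [exact: polybounded_const | exact: polybounded_id | apply: polybounded_add |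
        apply: polybounded_mul].
  have Pc : polybounded cost.
    by repeat first [exact: polybounded_const | exact: polybounded_id | assumption
      | exact: (polybounded_comp P1 PW) | exact: (polybounded_comp P2 PW)
      | exact: (polybounded_comp Ph PV) | exact: (polybounded_comp Pt PV) | apply:
          polybounded_add | apply: polybounded_mul].
  by repeat first [exact: polybounded_const | exact: Pc | apply: polybounded_add | apply:
      polybounded_mul].
exists main, e => x k H B F heads bits HF.
pose S := node_bound M H.
have card (s : seq (node M)) : uniq s -> (forall z, z \in s -> reach x k z) -> size s <= S.
  exact: reach_bound heads s.
have stable t z := @num_stable M x k B bits S card t z.
have FS : num x k S (node0 M) = F := num_acc_num bits card HF.
have S0 : 0 < S.
  by have [_ ] := node_bound_ge M H; rewrite -/S; lia.
have s0 : sound x k S [:: (node0 M, [::])] by exact: sound0.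
have [n Hn E] := pass_terminates stable card s0.
have si i : sound x k S (iter i (pass x k) [:: (node0 M, [::])]).
  by elim: i => //= i; apply: sound_pass.
have szi i : tsz (ttable (iter i (pass x k) [:: (node0 M, [::])])) + 4 <= W S.
  by apply: tsz_table heads (erefl _) (si i) _; apply: sound_size card _ (si i).
have [m Hm W1] := exec_loop_rounds [::] [::] R1 M1 szi E.
set T := iter n _ _ in E W1.
pose v := lookup T (node0 M).
have Ev : bval v = F by rewrite -FS; exact: fixpoint_num (si n) E.
have sv : size v <= S.+1.
  have [U N _] := si n; rewrite -/T in U N.
  case/mapP: N => a Ha E0; rewrite /v E0 lookup_in //.
  exact: sound_size_val (si n) Ha.
have HV : tsz (tcons (tlist tbool (rev v)) tnil) <= V S.
  rewrite tsz_cons -[tsz tnil]/1; have := tsz_bits (rev v); rewrite size_rev /V.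
  by move: sv; move: (tsz _) (size v) => a b; lia.
have W2 := @exec_loop_print (x, k) _ _ _ _ _ _ [::] [::] Rh Mh Rt Mt HV.
have T1 : exec (x, k) main (on_D [::] [::])
    (on_D (enc (tcons tnil tnil) ++ [::]) ([::] ++ rev v)) (cost S).
  rewrite /cost; apply: exec_Seq; first exact: exec_pushes.
  apply: exec_Seq.
    apply: (exec_leq _ (exec_twhile W1)).
    have : n.+1 * (g1 (W S) + 10) <= (2 * S + 2) * (g1 (W S) + 10).
      by rewrite leq_mul2r; apply/orP; right; lia.
    by lia.
  apply: exec_Seq.
    apply: (exec_leq _ (R2 _ _ _ _)); apply: M2.
    rewrite (tsz_cons tnil) -[tsz tnil]/1.
    by have := szi n; rewrite -/T; move: (W S) (tsz (ttable T)) => w z; lia.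
  cbv beta; rewrite [ttl (tcons _ _)]/= tlookupE -/v (trevappE tbool _ [::]) [rev v ++ _]cats0.
  apply: (exec_leq _ (exec_twhile W2)).
  rewrite -addnA leq_add2r leq_mul2r size_rev; apply/orP; right; lia.
have [t [Ht Hh Ho]] := exec_program T1.
exists t; split=> //; first exact: leq_trans Ht (He S).
by rewrite Ho /= out_val_rev.
Qed.

Lemma peval_monomial D n : peval (nseq D 0 ++ [:: 1]) n = n ^ D.
Proof. by elim: D => [|D IH] /=; rewrite ?muln0 // IH expnS. Qed.

(** The polynomial is 1 + n^(D+1); its constant term takes care of n = 0. *)
Lemma peval_bound D n : (n + 1) ^ D.+1 <= 2 ^ D.+1 * peval (1 :: nseq D 0 ++ [:: 1]) n.
Proof.
rewrite /= peval_monomial -expnS.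
apply: (@leq_trans ((2 * maxn 1 n) ^ D.+1)); first by apply: leq_expn2r; lia.
rewrite expnMn leq_mul2l; apply/orP; right.
by case: (leqP 1 n) => H; rewrite ?leq_addl // exp1n leq_addr.
Qed.

Lemma pow_ilog n : 2 ^ ilog n <= 2 * (n + 1).
Proof.
rewrite /ilog expnS leq_mul2l /=; case: n => [|n] //.
by apply: leq_trans (trunc_logP _ _) _; lia.
Qed.

(** The exponent is linear in [ilog n + f]: the part with [ilog n] becomes a power of n, the part
    with f a factor in k alone. *)
Lemma node_bound_fpt (M : TM) C e : exists D E, forall n f,
  (node_bound M (C * (ilog n + f)) + 2) ^ e <=
  (2 ^ (D.+1 * f + E) - 1) * peval (1 :: nseq D 0 ++ [:: 1]) n.
Proof.
(* Since 4^(4(H+1)) = 2^(8(H+1)), the part of [H = C * (ilog n + f)] with [ilog n] contributes,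
   after raising to e, the power [8 * C * e] of [2 ^ ilog n]. *)
pose q := #|{: tm_state M}|; pose D := 8 * C * e.
(* In [q + 10], 2^q covers the control states, 2^8 the summand 1 in H + 1, and 2^2 the summand 2 of
   the base. [2 * D.+1] pays for replacing [2 ^ ilog n] by the polynomial, and the last 1 for the
   subtracted 1 in the factor. *)
exists D, ((q + 10) * e + 2 * D.+1 + 1) => n f.
set P := peval _ n; set l := ilog n.
have Hb : node_bound M (C * (l + f)) + 2 <= 2 ^ (q + 10 + 8 * C * (l + f)).
  have -> : q + 10 + 8 * C * (l + f) = 2 + (q + 8 * (C * (l + f)).+1) by lia.
  have -> : node_bound M (C * (l + f)) = q * 2 ^ (8 * (C * (l + f)).+1).
    by rewrite /node_bound (_ : 8 = 2 * 4) // -mulnA (expnM 2 2).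
  rewrite !expnD; have := ltn_expl q (isT : 1 < 2).
  have : 0 < 2 ^ (8 * (C * (l + f)).+1) by rewrite expn_gt0.
  by move: (2 ^ q) (2 ^ (8 * _)) => a b; nia.
have Hl : (2 ^ l) ^ D <= 2 ^ (2 * D.+1) * P.
  apply: (@leq_trans ((2 * (n + 1)) ^ D.+1)).
    apply: (@leq_trans ((2 * (n + 1)) ^ D)); first exact: leq_expn2r (pow_ilog n).
    by rewrite leq_exp2l ?leqnSn //; lia.
  by rewrite expnMn mul2n -addnn expnD -mulnA leq_mul2l peval_bound orbT.
apply: leq_trans (leq_expn2r _ Hb) _; rewrite -expnM.
have -> : (q + 10 + 8 * C * (l + f)) * e = (q + 10) * e + D * f + l * D by rewrite /D; lia.
rewrite expnD (expnM 2 l) -[2 ^ (D.+1 * f + _) - 1]/(_ - 1).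
apply: (@leq_trans (2 ^ ((q + 10) * e + D * f) * (2 ^ (2 * D.+1) * P))).
  by rewrite leq_mul2l Hl orbT.
rewrite mulnA -expnD leq_mul2r; apply/orP; right.
apply: (@leq_trans (2 ^ (D.+1 * f + ((q + 10) * e + 2 * D.+1)))).
  by rewrite leq_exp2l //; lia.
rewrite [D.+1 * f + (_ + 1)]addnA addn1 expnS.
by have := expn_gt0 2 (D.+1 * f + ((q + 10) * e + 2 * D.+1)); move: (2 ^ _) => r; lia.
Qed.

Theorem theorem9 : forall F : param_fun, sharp_para_beta_L F -> FFPT F.
Proof.
move=> F [M [[f [cf [C heads]]] [f' [_ bits]] HF]].
have [c [e Hc]] := counting_program M.
have [D [E HD]] := node_bound_fpt M C e.
exists (program c), (fun k => 2 ^ (D.+1 * f k + E) - 1), (1 :: nseq D 0 ++ [:: 1]).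
split; first exact: computable_exp.
move=> x k; have [t [Ht Hh Ho]] := Hc x k _ _ _ (heads x k) (bits x k) (HF x k).
by exists t; split=> //; apply: leq_trans Ht (HD _ _).
Qed.
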